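(* Let $r\ge 3$ be an integer. There exists $\gamma_0>0$ such that for every $\gamma\in(0,\gamma_0]$ there exists $\alpha_0>0$ such that for every $\alpha\in(0,\alpha_0]$ there exists $n_0\in\mathbb N$ such that the following holds for all $n\ge n_0$ with $r\mid n$. If $G$ is a graph on $n$ vertices with $\sigma(G)\ge 2(1-\frac1r-\alpha)n$ and $G$ contains no $\gamma$-independent set of size $\frac nr$, then $G$ has a $K_r$-factor.
   Context: All graphs are finite and simple. $\sigma(G):=\min\{d(x)+d(y): x\ne y,\ xy\notin E(G)\}$ (taken to be $+\infty$ if $G$ is complete). For an $n$-vertex graph $G$ and $\gamma>0$, a set $S\subseteq V(G)$ is $\gamma$-independent if $G[S]$ has at most $\gamma n^2$ edges. A $K_r$-factor is a collection of vertex-disjoint copies of $K_r$ covering all vertices of $G$. *)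

(* Defs.v *)
From HB Require Import structures.
From mathcomp Require Import all_boot all_order all_algebra.
From mathcomp Require Export reals.
Set Implicit Arguments. Unset Strict Implicit. Unset Printing Implicit Defensive.
Import Order.TTheory GRing.Theory Num.Theory.

Definition simple_graph (T : finType) (e : rel T) : Prop :=
  symmetric e /\ irreflexive e.

Definition deg (T : finType) (e : rel T) (x : T) : nat := #|[set y | e x y]|.

Definition edges_in (T : finType) (e : rel T) (S : {set T}) : nat :=
  #|[set A : {set T} | (A \subset S) && (#|A| == 2) &&
        [forall x in A, forall y in A, (x != y) ==> e x y]]|.

Definition gamma_indep (R : realType) (n : nat) (T : finType) (e : rel T)
  (gamma : R) (S : {set T}) : Prop :=
  ((edges_in e S)%:R <= gamma * (n%:R) ^+ 2)%R.

(* sigma(G) >= c, with sigma = +oo for complete graphs (vacuous) *)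
Definition sigma_ge (R : realType) (T : finType) (e : rel T) (c : R) : Prop :=
  forall x y : T, x != y -> ~~ e x y -> (c <= (deg e x + deg e y)%:R)%R.

Definition clique (T : finType) (e : rel T) (A : {set T}) : bool :=
  [forall x in A, forall y in A, (x != y) ==> e x y].

Definition Kr_factor (T : finType) (e : rel T) (r : nat) : Prop :=
  exists P : {set {set T}},
    partition P [set: T] /\ (forall A, A \in P -> #|A| = r /\ clique e A).

(* Main.v *)
Require Import Defs.
From HB Require Import structures.
From mathcomp Require Import all_boot all_order all_algebra reals.
From mathcomp Require Import zify ring lra.
Set Implicit Arguments. Unset Strict Implicit. Unset Printing Implicit Defensive.
Import Order.TTheory GRing.Theory Num.Theory.

(** Absorption, with potential functions in place of random choices and of the
    regularity lemma.  Write [dbar v] for the number of vertices not adjacent to [v]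
    ([v] included) and [K = n / r].  Vertices with [dbar v] well above [K] form a
    clique (the "low" vertices), and since no set of size about [K] is sparse, every
    set of size about [j K] contains a positive proportion of the [(j+1)]-sets as
    cliques.  Hence any two vertices are linked by many exchange gadgets and every
    [r]-set [W] has a positive proportion of absorbers, words of [3 r ^ 2] vertices.

    The key tool is the dual form of a fractional tiling theorem (lemma [dual]): for
    every weight [g >= 0] on a set of [r k] vertices some [r]-clique [Q] satisfies
    [k * g(Q) >= g(V) + kappa * |g - a|_1 - O(max g)], with a gain [kappa > 0] if there are no
    sparse sets of size about [k], and with [kappa = 0] from the Ore condition alone.  Removing
    cliques that are good for the weight [g(u) = sum_v z_v^3 [u, v not adjacent]], where
    [z_v] is the excess of [dbar v] over its proportional share in the remaining
    set, keeps all [z_v] of order [n ^ (3/4)], so the Ore condition survives.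

    First a small part of the graph is removed in supersteps, each consisting of one
    absorber that serves many sets [W] and of boundedly many cliques; the gain [kappa] of
    these cliques pays for the unbalance that the absorber creates.  Then the rest, which
    still satisfies the Ore condition, is tiled up to [O(alpha n)] vertices, after adding
    [O(alpha n)] universal vertices to make up for the deficit [alpha].  What is left is
    absorbed, [alpha] being small compared to the number of absorbers of each set. *)

(** * Factors and words *)

Section Factor.
Variables (T : finType) (e : rel T) (r : nat).

Definition factor (X : {set T}) : bool :=
  [exists P : {set {set T}}, partition P X &&
     [forall A in P, (#|A| == r) && clique e A]].

Lemma factorP (X : {set T}) :
  reflect (exists P : {set {set T}}, partition P X /\
             (forall A, A \in P -> #|A| = r /\ clique e A)) (factor X).
Proof.
apply: (iffP existsP) => [[P /andP[pP /forall_inP aP]]|[P [pP aP]]].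
  by exists P; split=> // A /aP /andP[/eqP].
exists P; rewrite pP; apply/forall_inP => A /aP[-> ->]; by rewrite eqxx.
Qed.

Lemma factor0 : factor set0.
Proof.
apply/factorP; exists set0; split=> [|A]; last by rewrite inE.
by apply/and3P; split; rewrite ?inE // /trivIset /cover ?big_set0 // cards0.
Qed.

Lemma factor_clique (A : {set T}) : (0 < r)%N -> #|A| = r -> clique e A -> factor A.
Proof.
move=> r0 cA kA; apply/factorP; exists [set A]; split=> [|B]; last first.
  by rewrite inE => /eqP ->.
apply/and3P; split; first by rewrite /cover big_set1.
  by rewrite /trivIset /cover !big_set1.
by rewrite inE eq_sym -cards_eq0 cA -lt0n.
Qed.

Lemma factorU (X Y : {set T}) :
  [disjoint X & Y] -> factor X -> factor Y -> factor (X :|: Y).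
Proof.
move=> dXY /factorP[P [/and3P[/eqP cP tP nP] aP]] /factorP[Q [/and3P[/eqP cQ tQ nQ] aQ]].
apply/factorP; exists (P :|: Q); split=> [|A]; last first.
  by rewrite inE => /orP[/aP|/aQ].
have coverU : cover (P :|: Q) = X :|: Y by rewrite /cover bigcup_setU -!/(cover _) cP cQ.
apply/and3P; split; first by rewrite coverU.
  apply/trivIsetP => A B; rewrite !inE => /orP[] PA /orP[] QB AB.
  - exact: (trivIsetP tP).
  - apply: disjointW dXY; [rewrite -cP|rewrite -cQ]; exact: bigcup_sup.
  - rewrite disjoint_sym; apply: disjointW dXY; [rewrite -cP|rewrite -cQ]; exact: bigcup_sup.
  - exact: (trivIsetP tQ).
by rewrite inE negb_or nP.
Qed.

Lemma dvdn_factor (X : {set T}) : factor X -> (r %| #|X|)%N.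
Proof.
move=> /factorP[P [pP aP]]; rewrite (card_partition pP).
by apply: dvdn_sum => A /aP[-> _].
Qed.

End Factor.

(** * Words over the vertex set and how they are counted *)

Section Words.
Variable T : finType.

Fixpoint words (m : nat) : seq (seq T) :=
  if m is m'.+1 then [seq v :: s | v <- enum T, s <- words m'] else [:: [::]].

Lemma size_words m : size (words m) = (#|T| ^ m)%N.
Proof. by elim: m => // m IH /=; rewrite size_allpairs IH expnS cardE. Qed.

Lemma mem_words m s : (s \in words m) = (size s == m).
Proof.
elim: m s => [|m IH] [|v s] //=.
  by apply/allpairsP => -[[a b] /= []].
rewrite eqSS -IH; apply/allpairsP/idP => [[[a b] /= [_ sb [_ ->]]] //|sw].
by exists (v, s); rewrite /= mem_enum.
Qed.

(** A tree of choices rather than a number of words: after every admissible beginning at least [c]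
    letters are admissible. In this form greedy constructions can be concatenated, the second
    depending on the outcome of the first; the conversion to a count, [many_count], comes last. *)
Fixpoint many (c m : nat) (P : seq T -> Prop) : Prop :=
  if m is m'.+1
  then exists2 A : {set T}, (c <= #|A|)%N & forall v, v \in A -> many c m' (fun s => P (v :: s))
  else P [::].

Lemma many_impl c m (P Q : seq T -> Prop) :
  (forall s, size s = m -> P s -> Q s) -> many c m P -> many c m Q.
Proof.
elim: m P Q => [|m IH] P Q PQ /=; first exact: PQ.
by move=> [A cA AP]; exists A => // v /AP; apply: IH => s ss; apply: PQ; rewrite /= ss.
Qed.

Lemma many_cat c m m' (P Q : seq T -> Prop) :
  many c m P -> (forall s, size s = m -> P s -> many c m' (fun s' => Q (s ++ s'))) ->
  many c (m + m') Q.
Proof.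
elim: m P Q => [|m IH] P Q /=; first by move=> P0 /(_ [::] erefl P0).
move=> [A cA AP] PQ; exists A => // v vA; apply: IH (AP v vA) _ => s ss Ps.
by have := PQ (v :: s) _ Ps; rewrite /= ss; apply.
Qed.

Lemma many_count c m (P : seq T -> Prop) (p : pred (seq T)) :
  (forall s, P s -> p s) -> many c m P -> (c ^ m <= count p (words m))%N.
Proof.
elim: m P p => [|m IH] P p Pp /=; first by move=> /Pp pn; rewrite pn.
move=> [A cA AP].
have : (#|A| * c ^ m <= count p [seq v :: s | v <- enum T, s <- words m])%N.
  rewrite -sum_nat_const count_flatten -map_comp sumnE big_map big_enum /=.
  apply: (@leq_trans (\sum_(i in A) count p [seq i :: s | s <- words m])%N).
    apply: leq_sum => v vA; rewrite count_map; apply: IH (AP v vA) => s Ps; exact: Pp.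
  by rewrite [leqRHS](bigID (mem A)) /= leq_addr.
by apply: leq_trans; rewrite expnS leq_mul2r cA orbT.
Qed.

(** Double counting: in each of the [m] positions a given letter stands in [#|T| ^ m.-1] words. This
    yields the mean cost of a word when an absorber is chosen. *)
Lemma sum_words_mem (R : pzRingType) (f : T -> R) m :
  (\sum_(s <- words m) \sum_(x <- s) f x = (m * #|T| ^ m.-1)%:R * \sum_x f x)%R.
Proof.
elim: m => [|m IH] /=; first by rewrite big_seq1 big_nil mul0n mul0r.
rewrite big_allpairs_dep big_enum /=.
have inner v : (\sum_(s <- words m) \sum_(x <- v :: s) f x =
    f v *+ #|T| ^ m + (m * #|T| ^ m.-1)%:R * \sum_x f x)%R.
  under eq_bigr => s _ do rewrite big_cons.
  by rewrite big_split /= IH big_const_seq count_predT size_words iter_addr_0.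
rewrite (eq_bigr _ (fun v _ => inner v)) big_split /= sumr_const sumrMnl.
rewrite -[X in (X + _)%R]mulr_natl -[X in (_ + X)%R]mulr_natl mulrA -natrM -mulrDl -natrD.
congr (_%:R * _)%R; case: m {IH inner} => [|m] /=; first by rewrite mul0n muln0.
by rewrite mulnCA -expnS mulSn.
Qed.

End Words.

(** * Exchange gadgets and absorbers *)

Notation seqset s := [set x in s].

Lemma seqset_cons (T : finType) (x : T) s : seqset (x :: s) = x |: seqset s.
Proof. by apply/setP => y; rewrite !inE. Qed.

Lemma seqset_cat (T : finType) (s t : seq T) : seqset (s ++ t) = seqset s :|: seqset t.
Proof. by apply/setP => y; rewrite !inE mem_cat. Qed.

Lemma card_seqset (T : finType) (s : seq T) : uniq s -> #|seqset s| = size s.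
Proof. by move=> us; rewrite cardsE; apply/card_uniqP. Qed.

Lemma disjoint_setUr (T : finType) (A B C : {set T}) :
  [disjoint A & B :|: C] = [disjoint A & B] && [disjoint A & C].
Proof. by rewrite -!setI_eq0 setIUr setU_eq0. Qed.

Lemma disjoint_setUl (T : finType) (A B C : {set T}) :
  [disjoint B :|: C & A] = [disjoint B & A] && [disjoint C & A].
Proof. by rewrite -!setI_eq0 setIUl setU_eq0. Qed.

Section Absorb.
Variables (T : finType) (e : rel T) (r : nat).
Hypotheses (esym : symmetric e) (eirr : irreflexive e).

Definition adj v : {set T} := [set u | e v u].
Definition nonadj v : {set T} := [set u | ~~ e v u].

Lemma setC_adj v : ~: adj v = nonadj v.
Proof. by apply/setP => u; rewrite !inE. Qed.

Lemma card_adjI v (N : {set T}) : #|N| = (#|N :&: adj v| + #|N :&: nonadj v|)%N.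
Proof. by rewrite -(cardsID (adj v) N) setDE setC_adj. Qed.

Definition clique_seq (N : {set T}) s := pairwise e s && all (mem N) s.

Lemma clique_seq_uniq N s : clique_seq N s -> uniq s.
Proof.
case/andP => + _; rewrite uniq_pairwise; apply: sub_pairwise => x y exy.
by apply: contraTN exy => /eqP ->; rewrite eirr.
Qed.

Lemma clique_seq_cons (N : {set T}) v s :
  v \in N -> clique_seq (N :&: adj v) s -> clique_seq N (v :: s).
Proof.
move=> vN /andP[ps /allP sN]; rewrite /clique_seq /= ps vN /= andbT; apply/andP; split.
  by apply/allP => u /sN; rewrite !inE => /andP[].
by apply/allP => u /sN; rewrite !inE => /andP[].
Qed.

Lemma clique_seqW (N N' : {set T}) s : N \subset N' -> clique_seq N s -> clique_seq N' s.
Proof.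
move=> /subsetP NN' /andP[ps /allP sN]; rewrite /clique_seq ps /=.
by apply/allP => u /sN /NN'.
Qed.

Lemma clique_seqset N s : clique_seq N s -> clique e (seqset s).
Proof.
case/andP => ps _; apply/forall_inP => x; rewrite inE => xs.
apply/forall_inP => y; rewrite inE => ys; apply/implyP => xy.
have e_sym : symmetric (fun x y => (x == y) || e x y) by move=> a b; rewrite eq_sym esym.
have : pairwise (fun x y => (x == y) || e x y) s.
  by apply: sub_pairwise ps => a b ->; rewrite orbT.
move/(pairwiseP x) => pP.
have [ix iy] : (index x s < size s)%N /\ (index y s < size s)%N by rewrite !index_mem.
have [lt|lt|eqi] := ltngtP (index x s) (index y s).
- by have := pP _ _ ix iy lt; rewrite !nth_index // (negbTE xy).
- by have := pP _ _ iy ix lt; rewrite !nth_index // eq_sym (negbTE xy) esym.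
- by case/negP: xy; rewrite -(nth_index x xs) eqi nth_index.
Qed.

Lemma factor_clique_seq N s : (0 < r)%N -> clique_seq N s -> size s = r -> factor e r (seqset s).
Proof.
move=> r0 cs ss; apply: factor_clique => //; last exact: clique_seqset cs.
by rewrite card_seqset // (clique_seq_uniq cs).
Qed.

(** An exchange gadget. [F] collects the vertices already committed; in the uses it contains [xs]
    and [ys], so that the unions below are disjoint. *)
Definition swap (xs ys : seq T) (F : {set T}) s :=
  [&& uniq s, [disjoint seqset s & F],
      factor e r (seqset xs :|: seqset s) & factor e r (seqset ys :|: seqset s)].

(** Two gadgets in series: next to [x], the tiling joins [x] to [s1] and [z] to [s2]; next to [y],
    it joins [z] to [s1] and [y] to [s2]. *)
Lemma swap_trans x y z (F : {set T}) s1 s2 :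
  x \in F -> y \in F -> z \notin F ->
  swap [:: x] [:: z] (z |: F) s1 -> swap [:: z] [:: y] (seqset s1 :|: (z |: F)) s2 ->
  swap [:: x] [:: y] F (z :: s1 ++ s2).
Proof.
move=> xF yF zF /and4P[u1 d1 fx1 fz1] /and4P[u2 d2 fz2 fy2].
have s1F u : u \in s1 -> (u == z) || (u \in F) -> False.
  move=> us uF; move: d1; rewrite -setI_eq0 => /eqP/setP/(_ u); rewrite !inE us.
  by rewrite uF.
have s2F u : u \in s2 -> [|| u \in s1, u == z | u \in F] -> False.
  move=> us uF; move: d2; rewrite -setI_eq0 => /eqP/setP/(_ u); rewrite !inE us.
  by rewrite uF.
have xz : x != z by apply: contraNneq zF => <-.
have yz : y != z by apply: contraNneq zF => <-.
have U w : w \in F -> factor e r (seqset [:: w] :|: seqset s1) ->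
   factor e r (seqset [:: z] :|: seqset s2) -> factor e r (seqset [:: w] :|: seqset (z :: s1 ++ s2)).
  move=> wF f1 f2; rewrite (seqset_cons z) seqset_cat.
  rewrite (_ : _ :|: _ = (seqset [:: w] :|: seqset s1) :|: (seqset [:: z] :|: seqset s2)); last first.
    by apply/setP => u; rewrite !inE; do ![case: (_ \in _)|case: (_ == _)].
  apply: factorU => //; rewrite -setI_eq0; apply/eqP/setP => u; rewrite !inE.
  apply/negbTE/negP => /andP[/orP[/eqP->|us1] /orP[/eqP uz|us2]].
  - by move: wF; rewrite uz (negbTE zF).
  - by apply: (s2F _ us2); rewrite wF !orbT.
  - by apply: (s1F _ us1); rewrite uz eqxx.
  - by apply: (s2F _ us2); rewrite us1.
have V w : w \in F -> factor e r (seqset [:: z] :|: seqset s1) ->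
   factor e r (seqset [:: w] :|: seqset s2) -> factor e r (seqset [:: w] :|: seqset (z :: s1 ++ s2)).
  move=> wF f1 f2; rewrite (seqset_cons z) seqset_cat.
  rewrite (_ : _ :|: _ = (seqset [:: z] :|: seqset s1) :|: (seqset [:: w] :|: seqset s2)); last first.
    by apply/setP => u; rewrite !inE; do ![case: (_ \in _)|case: (_ == _)].
  apply: factorU => //; rewrite -setI_eq0; apply/eqP/setP => u; rewrite !inE.
  apply/negbTE/negP => /andP[/orP[/eqP uz|us1] /orP[/eqP uw|us2]].
  - by move: wF; rewrite -uw uz (negbTE zF).
  - by apply: (s2F _ us2); rewrite uz eqxx !orbT.
  - by apply: (s1F _ us1); rewrite uw wF orbT.
  - by apply: (s2F _ us2); rewrite us1.
apply/and4P; split; [|rewrite -setI_eq0; apply/eqP/setP => u; rewrite !inE mem_cat|exact: U|exact: V].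
  rewrite /= mem_cat cat_uniq u1 u2 andbT /= negb_or; apply/andP; split.
    by apply/andP; split; apply/negP => zs; [apply: (s1F _ zs)|apply: (s2F _ zs)]; rewrite eqxx ?orbT.
  by apply/hasPn => u us; apply/negP => us1; apply: (s2F _ us); rewrite us1.
apply/negbTE/negP => /andP[/or3P[/eqP->|us|us] uF].
- by rewrite uF in zF.
- by apply: (s1F _ us); rewrite uF orbT.
- by apply: (s2F _ us); rewrite uF !orbT.
Qed.

Lemma swap_cat x y xs ys (F : {set T}) s1 s2 :
  x \notin xs -> y \notin ys -> {subset x :: xs <= F} -> {subset y :: ys <= F} ->
  swap [:: x] [:: y] F s1 -> swap xs ys (seqset s1 :|: F) s2 ->
  swap (x :: xs) (y :: ys) F (s1 ++ s2).
Proof.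
move=> xxs yys xF yF /and4P[u1 d1 fx1 fy1] /and4P[u2 d2 fx2 fy2].
have s1F u : u \in s1 -> u \in F -> False.
  move=> us uF; move: d1; rewrite -setI_eq0 => /eqP/setP/(_ u); rewrite !inE us.
  by rewrite uF.
have s2F u : u \in s2 -> (u \in s1) || (u \in F) -> False.
  move=> us uF; move: d2; rewrite -setI_eq0 => /eqP/setP/(_ u); rewrite !inE us.
  by rewrite uF.
have U w ws : w \notin ws -> {subset w :: ws <= F} -> factor e r (seqset [:: w] :|: seqset s1) ->
   factor e r (seqset ws :|: seqset s2) -> factor e r (seqset (w :: ws) :|: seqset (s1 ++ s2)).
  move=> wws wF f1 f2; rewrite seqset_cons seqset_cat.
  rewrite (_ : _ :|: _ = (seqset [:: w] :|: seqset s1) :|: (seqset ws :|: seqset s2)); last first.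
    by apply/setP => u; rewrite !inE; do ![case: (_ \in _)|case: (_ == _)].
  apply: factorU => //; rewrite -setI_eq0; apply/eqP/setP => u; rewrite !inE.
  apply/negbTE/negP => /andP[/orP[/eqP uw|us1] /orP[uws|us2]].
  - by move: wws; rewrite -uw uws.
  - by apply: (s2F _ us2); rewrite wF ?orbT // uw mem_head.
  - by apply: (s1F _ us1); rewrite wF // inE uws orbT.
  - by apply: (s2F _ us2); rewrite us1.
apply/and4P; split; [|rewrite -setI_eq0; apply/eqP/setP => u; rewrite !inE mem_cat|exact: U|exact: U].
  rewrite cat_uniq u1 u2 andbT /=; apply/hasPn => u us; apply/negP => us1.
  by apply: (s2F _ us); rewrite us1.
apply/negbTE/negP => /andP[/orP[us|us] uF].
- by apply: (s1F _ us); rewrite uF ?orbT.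
- by apply: (s2F _ us); rewrite uF !orbT.
Qed.

End Absorb.

(** * A positive proportion of gadgets and absorbers *)

Section ManyAbsorbers.
Variables (T : finType) (e : rel T) (r : nat).
Hypotheses (esym : symmetric e) (eirr : irreflexive e) (r3 : (2 < r)%N).
Variables D s0 c f : nat.

Notation adj := (adj e).
Notation nonadj := (nonadj e).

Definition low : {set T} := [set v | (D < #|nonadj v|)%N].

Definition ore := forall x y, x != y -> ~~ e x y -> (#|nonadj x| + #|nonadj y| <= 2 * D)%N.

(** The counting form of the absence of sparse sets: an edge inside [S] is chosen one end after the
    other, with [c] options each time. *)
Definition dense_edges := forall S : {set T}, (s0 <= #|S|)%N ->
  exists2 A : {set T}, A \subset S & (c <= #|A|)%N /\ forall v, v \in A -> (c <= #|S :&: adj v|)%N.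

Hypothesis oreP : ore.

Lemma low_adj x y : x \in low -> y \in low -> x != y -> e x y.
Proof.
rewrite !inE => lx ly xy; apply/negPn/negP => nxy.
by have := oreP xy nxy; lia.
Qed.

Lemma card_adjI_ge v (N : {set T}) : v \notin low -> (#|N| <= #|N :&: adj v| + D)%N.
Proof.
rewrite inE -leqNgt => vD; rewrite (card_adjI e v N) leq_add2l.
by apply: leq_trans vD; apply: subset_leq_card; rewrite subsetIr.
Qed.

Hypotheses (edgesP : dense_edges) (s0P : (2 * c + r <= s0)%N).
Hypotheses (DP : (c + f <= D)%N) (roomP : (s0 + (r - 1) * D + f <= #|T|)%N).

Lemma many_clique_low j (N : {set T}) : N \subset low -> (c + j <= #|N|)%N ->
  many c j (clique_seq e N).
Proof.
elim: j N => [|j IH] N NL cN //=.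
exists N => [|v vN]; first by lia.
have: many c j (clique_seq e (N :\ v)).
  apply: IH; first by apply: subset_trans NL; rewrite subsetDl.
  by have := cardsD1 v N; rewrite vN; lia.
apply: many_impl => s _ cs; apply: clique_seq_cons => //.
apply: clique_seqW cs; apply/subsetP => u; rewrite !inE => /andP[uv uN].
by rewrite uN /= low_adj ?(subsetP NL) // eq_sym.
Qed.

(** A vertex outside [low] costs at most [D] vertices of [N], so the induction ends in a set of size
    [s0], where [edgesP] supplies the last two letters. If many vertices of [N] are low, these alone
    give enough cliques. *)
Lemma many_clique j (N : {set T}) : (j.+2 <= r)%N -> (s0 + j * D <= #|N|)%N ->
  many c j.+2 (clique_seq e N).
Proof.
elim: j N => [|j IH] N jr sN.
  have [|A AN [cA Ac]] := edgesP (S := N); first by lia.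
  exists A => // v vA; exists (N :&: adj v) => [|u]; first exact: Ac.
  rewrite !inE => /andP[uN vu]; rewrite /= /clique_seq /= vu (subsetP AN) //= uN //.
have [NL|NL] := leqP (c + j.+3) #|N :&: low|.
  apply: many_impl (many_clique_low (subsetIr _ _) NL) => s _; exact/clique_seqW/subsetIl.
exists (N :\: low) => [|v]; first by have := cardsID low N; lia.
rewrite !in_setD => /andP[vL vN].
have /IH : (s0 + j * D <= #|N :&: adj v|)%N by have := card_adjI_ge N vL; lia.
move=> /(_ (ltnW jr)); apply: many_impl => s _; exact: clique_seq_cons.
Qed.

(** All but [2 * D] vertices are common neighbours of [x] and [y]; outside [F] they contain many
    cliques of [r - 1] vertices, and each of these completes both [x] and [y]. *)
Lemma many_swap1 x y (F : {set T}) : x \in F -> y \in F -> (#|F| <= f)%N ->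
  (#|nonadj x| + #|nonadj y| <= 2 * D)%N -> many c r.-1 (swap e r [:: x] [:: y] F).
Proof.
move=> xF yF Ff xyD; set N := (adj x :&: adj y) :\: F.
have cN : (s0 + (r - 3) * D <= #|N|)%N.
  have /eqP := cardsID F (adj x :&: adj y); rewrite -/N.
  have := subset_leq_card (subsetIr (adj x :&: adj y) F).
  have := cardsC (adj x); rewrite setC_adj.
  have := card_adjI e y (adj x).
  have := subset_leq_card (subsetIr (adj x) (nonadj y)).
  have : (s0 + (r - 1) * D + f <= #|T|)%N by [].
  have -> : ((r - 1) * D = (r - 3) * D + 2 * D)%N by rewrite -mulnDl; congr (_ * _)%N; lia.
  move: ((r - 3) * D)%N => Q; lia.
have {cN} /many_clique : (s0 + (r - 3) * D <= #|N|)%N by [].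
rewrite (_ : (r - 3).+2 = r.-1); last by lia.
move=> /(_ (leq_pred _)); apply: many_impl => s ss cs.
have us := clique_seq_uniq eirr cs.
have sN u : u \in s -> [&& u \notin F, e x u & e y u].
  by case/andP: cs => _ /allP sN /sN; rewrite !inE.
have fac w : w \in F -> (forall u, u \in s -> e w u) -> factor e r (seqset [:: w] :|: seqset s).
  move=> wF ws; rewrite -seqset_cat; apply: (@factor_clique_seq _ _ _ esym eirr setT).
  - by lia.
  - rewrite /clique_seq /= (introT allP ws) (andP cs).1 inE /=.
    by apply/allP => u; rewrite /= inE.
  - by rewrite /= ss; lia.
apply/and4P; split=> //.
- rewrite -setI_eq0; apply/eqP/setP => u; rewrite !inE; apply/negbTE/negP => /andP[/sN/andP[uF _]].
  by rewrite (negbTE uF).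
- by apply: fac => // u /sN /and3P[].
- by apply: fac => // u /sN /and3P[].
Qed.

(* If [x] is low, its non-neighbours serve: they are not low, and by [oreP] their number of
   non-neighbours compensates that of [x]. *)
Lemma hub_set x (F : {set T}) : (#|F| < f)%N ->
  exists2 Z : {set T}, (c <= #|Z|)%N &
    forall z, z \in Z -> [/\ z \notin F, z \notin low & (#|nonadj x| + #|nonadj z| <= 2 * D)%N].
Proof.
move=> Ff.
have nl w : w \in low -> (D <= #|nonadj w :\ w :\: low|)%N /\ nonadj w :\ w :\: low = nonadj w :\ w.
  move=> wL; have -> : nonadj w :\ w :\: low = nonadj w :\ w.
    apply/setDidPl; rewrite -setI_eq0; apply/eqP/setP => u; rewrite in_setI in_setD in_set0 in_set1.
    apply/negbTE/negP => /andP[/andP[uw]]; rewrite inE => /negP wu uL; apply: wu.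
    by apply: low_adj; rewrite // eq_sym.
  split=> //; have := cardsD1 w (nonadj w); rewrite [w \in _]inE eirr /=.
  by move: wL; rewrite inE; lia.
have bigD (X : {set T}) : (D <= #|X|)%N -> (c <= #|X :\: F|)%N.
  move=> DX; have := cardsID F X; have := subset_leq_card (subsetIr X F); lia.
have [xL|xL] := boolP (x \in low).
  have [DX XE] := nl x xL; exists (nonadj x :\ x :\: low :\: F); first exact: bigD.
  move=> z; rewrite !in_setD => /andP[zF /andP[zL]]; rewrite in_set1 => /andP[zx].
  by rewrite inE => xz; split=> //; apply: oreP; rewrite // eq_sym.
exists (~: low :\: F) => [|z]; last first.
  rewrite in_setD in_setC => /andP[zF zL]; split=> //; move: xL zL; rewrite !inE; lia.
apply: bigD; have [E|[w wL]] := set_0Vmem low; last first.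
  have [DX _] := nl w wL; apply: leq_trans DX _; apply: subset_leq_card.
  by apply/subsetP => u; rewrite in_setD in_setC => /andP[].
rewrite E setC0 cardsT; have : (s0 + (r - 1) * D + f <= #|T|)%N by [].
have : (1 * D <= (r - 1) * D)%N by rewrite leq_mul2r; apply/orP; right; lia.
lia.
Qed.

Lemma card_setU_seqset (F : {set T}) s : (#|seqset s :|: F| <= size s + #|F|)%N.
Proof.
apply: leq_trans (leq_card_setU _ _) _; rewrite leq_add2r.
by rewrite cardsE card_size.
Qed.

Lemma card_setU_swap xs ys (F : {set T}) z s : size s = r.-1 ->
  swap e r xs ys (z |: F) s -> (#|seqset s :|: (z |: F)| <= #|F| + r)%N.
Proof.
move=> ss _; apply: leq_trans (card_setU_seqset _ _) _; rewrite ss cardsU1; lia.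
Qed.

(** One intermediate vertex is enough here: a hub [z] of [y] is not low, hence [x] and [z] also have
    at most [2 * D] non-neighbours together. *)
Lemma many_swap2 x y (F : {set T}) : x \in F -> y \in F -> x \notin low -> (#|F| + 2 * r <= f)%N ->
  many c (r.-1 + r.-1).+1 (swap e r [:: x] [:: y] F).
Proof.
move=> xF yF xL Ff; have [|Z cZ ZP] := @hub_set y F; first by lia.
exists Z => // z /ZP[zF zL yz].
apply: (many_cat (P := swap e r [:: x] [:: z] (z |: F))).
  apply: many_swap1; [exact: setU1r|exact: setU11| |].
    by rewrite cardsU1 zF; lia.
  by move: xL zL; rewrite !inE; lia.
move=> s ss sw; have cF1 := card_setU_swap ss sw.
apply: many_impl (fun t _ => swap_trans xF yF zF sw (s2 := t)) _.
apply: many_swap1.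
- by rewrite inE setU11 orbT.
- by rewrite inE (setU1r _ yF) orbT.
- by apply: leq_trans cF1 _; lia.
- by rewrite addnC.
Qed.

(** A hub of [x] is not low, which reduces to the preceding case with the hub as start. Taking this
    detour for every pair gives all gadgets the same length. *)
Lemma many_swap x y (F : {set T}) : x \in F -> y \in F -> (#|F| + 3 * r <= f)%N ->
  many c (3 * r).-1 (swap e r [:: x] [:: y] F).
Proof.
move=> xF yF Ff.
rewrite (_ : (3 * r).-1 = (r.-1 + (r.-1 + r.-1).+1).+1); last by lia.
have [|Z cZ ZP] := @hub_set x F; first by lia.
exists Z => // z /ZP[zF zL xz].
apply: (many_cat (P := swap e r [:: x] [:: z] (z |: F))).
  apply: many_swap1; [exact: setU1r|exact: setU11| |by []].
  by rewrite cardsU1 zF; lia.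
move=> s ss sw; have cF1 := card_setU_swap ss sw.
apply: many_impl (fun t _ => swap_trans xF yF zF sw (s2 := t)) _.
apply: many_swap2 zL _.
- by rewrite inE setU11 orbT.
- by rewrite inE (setU1r _ yF) orbT.
- by apply: leq_trans (leq_add cF1 (leqnn _)) _; lia.
Qed.

Lemma many_swaps xs ys (F : {set T}) : uniq xs -> uniq ys -> size xs = size ys ->
  {subset xs <= F} -> {subset ys <= F} -> (#|F| + size xs * (3 * r) <= f)%N ->
  many c (size xs * (3 * r).-1) (swap e r xs ys F).
Proof.
elim: xs ys F => [|x xs IH] [|y ys] F //.
  move=> _ _ _ _ _ _ /=; apply/and4P; split=> //; rewrite ?set_nil //.
  - by rewrite -setI_eq0; apply/eqP/setP => u; rewrite !inE.
  - by rewrite (_ : _ :|: _ = set0) ?factor0 //; apply/setP => u; rewrite !inE.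
  - by rewrite (_ : _ :|: _ = set0) ?factor0 //; apply/setP => u; rewrite !inE.
move=> /= /andP[xxs uxs] /andP[yys uys] [sz] xF yF; rewrite !mulSn => Ff.
have sF s : size s = (3 * r).-1 -> (#|seqset s :|: F| <= 3 * r + #|F|)%N.
  by move=> ss; apply: leq_trans (card_setU_seqset _ _) _; rewrite ss; lia.
apply: (many_cat (P := swap e r [:: x] [:: y] F)).
  apply: many_swap; [exact/xF/mem_head|exact/yF/mem_head|].
  by apply: leq_trans Ff; rewrite leq_add2l leq_addr.
move=> s1 ss1 sw1.
have: many c (size xs * (3 * r).-1) (swap e r xs ys (seqset s1 :|: F)).
  apply: IH => //; last first.
      by apply: leq_trans (leq_add (sF s1 ss1) (leqnn _)) _; rewrite -addnA addnCA.
    by move=> u ux; rewrite inE yF ?orbT // inE ux orbT.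
  by move=> u ux; rewrite inE xF ?orbT // inE ux orbT.
exact: many_impl (fun t _ => swap_cat xxs yys xF yF sw1 (s2 := t)).
Qed.

Definition absorbs (W : {set T}) s :=
  [&& uniq s, [disjoint seqset s & W], factor e r (seqset s) &
      factor e r (W :|: seqset s)].

(** An absorber is a clique [ys] followed by gadgets that exchange [W] for [ys] vertex by vertex.
    Without [W], the gadgets are tiled with [ys]; with [W], they are tiled with [W], and [ys] is a
    tile by itself. The length is [r + r * (3 * r - 1)]. *)
Lemma many_absorbs (W F : {set T}) : #|W| = r -> (#|F| + 2 * r + 3 * r ^ 2 <= f)%N ->
  many c (3 * r ^ 2) (fun s => absorbs W s && [disjoint seqset s & F]).
Proof.
move=> cW Ff; have r2 : (r ^ 2 = r * r)%N by rewrite expnS expn1.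
rewrite (_ : (3 * r ^ 2)%N = (r + r * (3 * r).-1)%N); last first.
  by rewrite r2; case: (r) r3 => // q _; rewrite mulnA; nia.
have cWF : (#|W :|: F| <= r + #|F|)%N by rewrite -cW leq_card_setU.
have cN : (s0 + (r - 2) * D <= #|~: (W :|: F)|)%N.
  have := cardsC (W :|: F); have : (s0 + (r - 1) * D + f <= #|T|)%N by [].
  have : ((r - 2) * D <= (r - 1) * D)%N by rewrite leq_mul2r; apply/orP; right; lia.
  lia.
apply: (many_cat (P := clique_seq e (~: (W :|: F)))).
  by have := many_clique _ cN; rewrite (_ : (r - 2).+2 = r) ?leqnn; [apply|lia].
move=> ys sys cys; have uys := clique_seq_uniq eirr cys.
have ysN u : u \in ys -> u \notin W :|: F.
  by case/andP: cys => _ /allP sN /sN; rewrite !inE.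
have szW : size (enum W) = r by rewrite -cardE.
have eW : seqset (enum W) = W by apply/setP => u; rewrite inE mem_enum.
have : many c (size (enum W) * (3 * r).-1) (swap e r (enum W) ys (seqset ys :|: (W :|: F))).
  apply: many_swaps; rewrite ?enum_uniq ?szW ?sys //.
  - by move=> u; rewrite mem_enum !inE => ->; rewrite !orbT.
  - by move=> u uy; rewrite !inE uy.
  - apply: (@leq_trans (size ys + #|W :|: F| + r * (3 * r))); last by rewrite sys mulnCA -r2; lia.
    by rewrite leq_add2r card_setU_seqset.
rewrite szW; apply: many_impl => s ss /and4P[us ds fx fy].
rewrite !disjoint_setUr in ds; case/and3P: ds => dsy dsW dsF.
have dys (X : {set T}) : X \subset W :|: F -> [disjoint seqset ys & X].
  move=> XWF; rewrite -setI_eq0; apply/eqP/setP => u; rewrite !inE.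
  apply/negbTE/negP => /andP[/ysN uN /(subsetP XWF)]; exact/negP.
apply/andP; split; last by rewrite seqset_cat disjoint_setUl dsF dys ?subsetUr.
apply/and4P; split.
- rewrite cat_uniq uys us andbT /=; apply/hasPn => u us'; apply/negP => uy.
  by move: dsy; rewrite -setI_eq0 => /eqP/setP/(_ u); rewrite !inE us' /mem /= uy.
- by rewrite seqset_cat disjoint_setUl dsW dys ?subsetUl.
- by rewrite seqset_cat.
- rewrite seqset_cat setUCA; apply: factorU.
  + by rewrite disjoint_setUr dys ?subsetUl //= disjoint_sym.
  + by apply: factor_clique_seq cys sys => //; lia.
  + by rewrite -[W in W :|: _]eW.
Qed.

End ManyAbsorbers.

(** * The dual lemma *)

Lemma subset_of_card (T : finType) (A : {set T}) j : (j <= #|A|)%N ->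
  exists2 B : {set T}, B \subset A & #|B| = j.
Proof.
move=> jA; exists (seqset (take j (enum A))).
  by apply/subsetP => u; rewrite inE => /mem_take; rewrite mem_enum.
rewrite card_seqset ?take_uniq ?enum_uniq // size_take -cardE.
by case: ltngtP jA => // ->.
Qed.

Lemma cliqueU1 (T : finType) (e : rel T) (esym : symmetric e) v (K : {set T}) :
  clique e K -> K \subset adj e v -> clique e (v |: K).
Proof.
move=> cK /subsetP Kv; apply/forall_inP => x; rewrite !inE => xK.
apply/forall_inP => y; rewrite !inE => yK; apply/implyP => xy.
case/orP: xK xy => [/eqP->|xK]; case/orP: yK => [/eqP->|yK] xy.
- by rewrite eqxx in xy.
- by have := Kv _ yK; rewrite inE.
- by have := Kv _ xK; rewrite inE esym.
- by move/forall_inP: cK => /(_ _ xK)/forall_inP/(_ _ yK)/implyP/(_ xy).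
Qed.

Lemma notin_adj (T : finType) (e : rel T) (eirr : irreflexive e) v (K : {set T}) :
  K \subset adj e v -> v \notin K.
Proof. by move=> /subsetP Kv; apply/negP => /Kv; rewrite inE eirr. Qed.

Local Open Scope ring_scope.

(** The last hypothesis says that the ordinary step fails to give the gain [K2]. Since [b <= DD] is
    barely more than [kk], and [K2] is far smaller than [K1], this leaves only a block of size [b]
    near [kk] with small total deficit [E], and a small variation [beta] outside the block. *)
Lemma dual_edge_num (R : realFieldType) (rr DD kk b om beta E K1 K2 : R) :
  0 < K1 <= 1 / 100 -> 0 < K2 <= 1 / 100 -> K2 * (400 * rr) <= K1 -> 1 <= rr -> 2 <= kk ->
  kk <= DD -> 4 * rr * (DD - kk) <= K2 * kk -> 0 <= b <= DD -> 0 <= om -> 0 <= beta -> 0 <= E ->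
  (kk - b) * om + E + K1 * beta < K2 * (beta + b * om + E) ->
  [/\ 0 < om, E <= 22 / 10 * K2 * (kk * om), rr * beta <= 11 / 2000 * (kk * om), kk - b <= K2 * b &
    beta + b * om + K2 * (beta + b * om + E) <= 11 / 8 * om * kk] /\
  b <= 101 / 100 * kk.
Proof.
move=> /andP[K10 K11] /andP[K20 K21] K12 r1 k0 kD' rD /andP[b0 bD] om_ge0 beta0 E0 lt.
have K22 : K2 <= K1 / 400.
  have : K2 * 400 * 1 <= K2 * 400 * rr.
    by apply: ler_wpM2l => //; apply: mulr_ge0 => //; apply: ltW.
  by move: K12; clear; lra.
have Ds : DD - kk <= K2 * kk / 4.
  have : 1 * (DD - kk) <= rr * (DD - kk) by apply: ler_wpM2r => //; rewrite subr_ge0.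
  by move: rD; clear; lra.
have kk0 : 0 <= kk by apply: le_trans k0; apply: ler0n.
have K2k : K2 * kk <= 1 / 100 * kk by apply: ler_wpM2r.
have bk : b <= 101 / 100 * kk by move: bD Ds K2k kk0; clear; lra.
have h1 : 0 <= (1 - K2) * E by apply: mulr_ge0 => //; move: K21; clear; lra.
have h2 : 0 <= (K1 - K2) * beta by apply: mulr_ge0 => //; move: K22 K10; clear; lra.
have om0 : 0 < om.
  rewrite lt_neqAle om_ge0 andbT; apply/eqP => om_eq; move: lt; rewrite -om_eq !mulr0 add0r addr0.
  by move: h1 h2; clear; lra.
have kom0 : 0 < kk * om by apply: mulr_gt0 => //; apply: lt_le_trans k0.
have lt2 : (K1 - K2) * beta + (1 - K2) * E < (K2 * b + (b - kk)) * om by move: lt; clear; lra.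
have up : K2 * b + (b - kk) <= 21 / 10 * K2 * kk.
  have : K2 * b <= K2 * (101 / 100 * kk) by apply: ler_wpM2l => //; apply: ltW.
  have : 0 <= K2 * kk by apply: mulr_ge0 => //; apply: ltW.
  by move: bD Ds; clear; lra.
have lt3 : (K1 - K2) * beta + (1 - K2) * E < 21 / 10 * K2 * (kk * om).
  by apply: lt_le_trans lt2 _; rewrite mulrA; apply: ler_wpM2r.
have K2kom : 0 <= K2 * (kk * om) by apply: mulr_ge0; apply: ltW.
have E1 : E <= 22 / 10 * K2 * (kk * om).
  have : 99 / 100 * E <= (1 - K2) * E by apply: ler_wpM2r => //; move: K21; clear; lra.
  by move: h2 lt3 K2kom; clear; lra.
have beta1 : rr * beta <= 11 / 2000 * (kk * om).
  have h3 : 99 / 100 * K1 * beta <= (K1 - K2) * beta.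
    by apply: ler_wpM2r => //; move: K22 K10; clear; lra.
  have h4 : 99 / 100 * (K1 * beta) <= 21 / 10 * K2 * (kk * om) by move: h1 h3 lt3; clear; lra.
  have h5 : rr * (99 / 100 * (K1 * beta)) <= rr * (21 / 10 * K2 * (kk * om)).
    by apply: ler_wpM2l => //; apply: le_trans r1.
  have h6 : K2 * (400 * rr) * (kk * om) <= K1 * (kk * om) by apply: ler_wpM2r => //; apply: ltW.
  have h8 : 0 <= K1 * (kk * om) by apply: mulr_ge0; apply: ltW.
  have h7 : K1 * (rr * beta) <= K1 * (11 / 2000 * (kk * om)) by move: h5 h6 h8; clear; lra.
  by rewrite ler_pM2l in h7.
have bbig : kk - b <= K2 * b.
  rewrite -(ler_pM2r om0); move: h1 h2 lt2; clear; lra.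
split=> //; split=> //.
have hb : b * om <= 101 / 100 * (kk * om) by rewrite mulrA; apply: ler_wpM2r.
have hbe : beta <= 11 / 2000 * (kk * om).
  by apply: le_trans beta1; rewrite -[leLHS]mul1r; apply: ler_wpM2r.
have hE : E <= 22 / 1000 * (kk * om).
  apply: le_trans E1 _; rewrite [leLHS](_ : _ = 22 / 10 * (K2 * (kk * om))) ?mulrA //.
  have : K2 * (kk * om) <= 1 / 100 * (kk * om) by apply: ler_wpM2r => //; apply: ltW.
  by clear; lra.
have h9 : K2 * (beta + b * om + E) <= 1 / 100 * (beta + b * om + E).
  by apply: ler_wpM2r => //; apply: addr_ge0 => //; apply: addr_ge0 => //; apply: mulr_ge0.
by move: h9 hE hbe hb kom0; clear; lra.
Qed.

Section Dual.
Variables (R : realFieldType) (T : finType) (e : rel T).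
Hypotheses (esym : symmetric e) (eirr : irreflexive e).
Variables (V0 L : {set T}) (k D : nat).
Hypothesis L_adj : forall x y, x \in L -> y \in L -> x != y -> e x y.
Hypothesis degP : forall v, v \in V0 -> v \notin L -> (#|V0 :\: adj e v| <= D)%N.

Lemma clique_subL (K : {set T}) : K \subset L -> clique e K.
Proof.
move=> /subsetP KL; apply/forall_inP => x /KL xL; apply/forall_inP => y /KL yL.
by apply/implyP; apply: L_adj.
Qed.

Lemma card_setI_adj v (N : {set T}) : v \in V0 -> v \notin L -> N \subset V0 ->
  (#|N| <= #|N :&: adj e v| + D)%N.
Proof.
move=> vV vL NV; rewrite -(cardsID (adj e v) N) leq_add2l.
by apply: leq_trans (degP vV vL); apply: subset_leq_card; apply: setSD.
Qed.

(** Greedy choice: a vertex outside [L] costs at most [D] vertices of [N], and [j] vertices of [N]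
    in [L] are a clique at once. *)
Lemma ex_clique j (N : {set T}) : N \subset V0 -> (j.-1 * D + j <= #|N|)%N ->
  exists K : {set T}, [/\ K \subset N, #|K| = j & clique e K].
Proof.
elim: j N => [|j IH] N NV sN.
  exists set0; split; rewrite ?sub0set ?cards0 //.
  by apply/forall_inP => x; rewrite inE.
have [NL|NL] := leqP j.+1 #|N :&: L|.
  have [K KN cK] := subset_of_card NL; exists K; split=> //.
    by apply: subset_trans KN _; rewrite subsetIl.
  by apply: clique_subL; apply: subset_trans KN _; rewrite subsetIr.
have [E|[v]] := set_0Vmem (N :\: L).
  have := cardsID L N; rewrite E cards0; lia.
rewrite inE => /andP[vL vN]; have vV := subsetP NV _ vN.
have cN := card_setI_adj vV vL NV.
have [||K [KN cK kK]] := IH (N :&: adj e v).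
- by apply: subset_trans NV; rewrite subsetIl.
- move: sN cN; rewrite /= -/(_ < _)%N; case: j {IH NL} => [|j] /=; first by lia.
  by rewrite mulSn; lia.
move: KN; rewrite subsetI => /andP[KN Kv].
exists (v |: K); split; last exact: cliqueU1.
- by rewrite subUset sub1set vN.
- by rewrite cardsU1 (notin_adj eirr Kv) cK.
Qed.

Lemma ex_max (g : T -> R) (A : {set T}) x0 : x0 \in A ->
  exists2 x, x \in A & forall y, y \in A -> g y <= g x.
Proof.
move=> x0A; exists [arg max_(x > x0 in A) g x]%O; case: arg_maxP => // x xA xm y yA; apply: xm.
Qed.

Lemma ex_top (g : T -> R) (Q : {set T}) l : (l <= #|Q|)%N ->
  exists K : {set T}, [/\ K \subset Q, #|K| = l &
    forall u w, u \in K -> w \in Q -> w \notin K -> g w <= g u].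
Proof.
elim: l => [|l IH] lQ; first by exists set0; rewrite sub0set cards0; split=> // u w; rewrite inE.
have [K [KQ cK Kt]] := IH (ltnW lQ).
have [E|[x0 x0QK]] := set_0Vmem (Q :\: K).
  by have := cardsD Q K; rewrite E cards0 (setIidPr KQ); lia.
have [x] := ex_max g x0QK; rewrite inE => /andP[xK xQ] xm.
exists (x |: K); split.
- by rewrite subUset sub1set xQ.
- by rewrite cardsU1 xK cK.
move=> u w; rewrite !inE negb_or => /orP[/eqP->|uK] wQ /andP[wx wK].
  by apply: xm; rewrite inE wK.
exact: Kt.
Qed.

(** The induction passes to neighbourhoods, whose size need not be [l * k]; the term in [a] accounts
    for the difference. It vanishes in the applications, where [#|V| = r * k]. *)
Definition dual_bound (g : T -> R) (V K : {set T}) (l : nat) (a kap err : R) : Prop :=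
  \sum_(u in V) g u + (l%:R * k%:R - #|V|%:R) * a + kap * \sum_(u in V) `|g u - a| - err
    <= k%:R * \sum_(u in K) g u.

Lemma sum_setD (V K : {set T}) (f : T -> R) : K \subset V ->
  \sum_(u in V) f u = \sum_(u in K) f u + \sum_(u in V :\: K) f u.
Proof. by move=> KV; rewrite (big_setID K) /= (setIidPr KV). Qed.

(** Let [a] be the least weight in [K]. The surplus of [K] over [a] counts [k >= 2] times on the
    right and [1 + kap <= 2] times on the left; the rest of [V] has weight at most [a], and its
    deficit counts [kap - 1 <= 0] times on the left. *)
Lemma dual_top (g : T -> R) M (V Q : {set T}) l (kap : R) :
  0 <= kap <= 1 -> (2 <= k)%N -> (0 < l)%N ->
  Q \subset V :&: L -> (l <= #|Q|)%N ->
  (forall q w, q \in Q -> w \in V -> w \notin Q -> g w <= g q) ->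
  (forall u, 0 <= g u <= M) ->
  exists (K : {set T}) (a : R), [/\ K \subset V, #|K| = l & clique e K] /\
    [/\ 0 <= a, exists2 x, x \in V & a <= g x & dual_bound g V K l a kap 0].
Proof.
move=> /andP[kap0 kap1] k2 l0 QV lQ Qt gM.
have [K [KQ cK Kt]] := ex_top g lQ.
have KV : K \subset V by apply: subset_trans KQ _; apply: subset_trans QV (subsetIl _ _).
have [x0 x0K] : exists x, x \in K by apply/set0Pn; rewrite -cards_eq0 cK -lt0n.
have [x xK xm] := ex_max (fun u => - g u) x0K.
have Ka u : u \in K -> g x <= g u by move=> /xm; rewrite lerN2.
have Va u : u \in V :\: K -> g u <= g x.
  rewrite inE => /andP[uK uV]; have [uQ|uQ] := boolP (u \in Q); first exact: Kt.
  by apply: Qt => //; apply: (subsetP KQ).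
exists K, (g x); split; split=> //.
- apply: clique_subL; apply: subset_trans KQ _; apply: subset_trans QV (subsetIr _ _).
- by case/andP: (gM x).
- by exists x => //; apply: (subsetP KV).
rewrite /dual_bound !(sum_setD _ KV).
have -> : \sum_(u in K) `|g u - g x| = \sum_(u in K) g u - l%:R * g x.
  rewrite -cK mulr_natl -sumr_const -sumrB; apply: eq_bigr => u uK.
  by rewrite ger0_norm // subr_ge0 Ka.
have -> : \sum_(u in V :\: K) `|g u - g x| = #|V :\: K|%:R * g x - \sum_(u in V :\: K) g u.
  rewrite mulr_natl -sumr_const -sumrB; apply: eq_bigr => u uK.
  by rewrite ler0_norm ?opprB // subr_le0 Va.
have -> : #|V|%:R = l%:R + #|V :\: K|%:R :> R.
  by rewrite -natrD -(cardsID K V) (setIidPr KV) cK.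
set S1 := \sum_(u in K) _; set S2 := \sum_(u in V :\: K) _.
have hS1 : l%:R * g x <= S1.
  by rewrite -cK mulr_natl -sumr_const; apply: ler_sum => u; apply: Ka.
have hS2 : S2 <= #|V :\: K|%:R * g x.
  by rewrite mulr_natl -sumr_const; apply: ler_sum => u; apply: Va.
have k2' : 2 <= k%:R :> R by rewrite ler_nat.
set c := #|V :\: K|%:R.
have h1 : 0 <= (1 - kap) * (c * g x - S2) by apply: mulr_ge0; lra.
have h2 : 0 <= (k%:R - 2) * (S1 - l%:R * g x) by apply: mulr_ge0; lra.
have h3 : 0 <= (1 - kap) * (S1 - l%:R * g x) by apply: mulr_ge0; lra.
rewrite /c in h1 *; lra.
Qed.

End Dual.

(** Conditions for a positive gain: sets smaller than [k] by a margin of order [kap j * k] still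
    span an edge, the slack [D - k] is negligible against every gain in use, and the gains decrease
    fast enough for [dual_edge_num]. *)
Definition robust (R : realFieldType) (T : finType) (e : rel T) (V0 : {set T}) (k D r0 : nat)
    (kap : nat -> R) (s0 : nat) :=
  [/\ forall S : {set T}, S \subset V0 -> (s0 <= #|S|)%N -> exists2 x, x \in S & exists2 y, y \in S & e x y,
      forall j, 0 < kap j <= 1 / 100 /\ kap j.+1 * (400 * r0%:R) <= kap j,
      forall j, (j <= r0)%N -> 4 * r0%:R * (D%:R - k%:R) <= kap j * k%:R,
      forall j, s0%:R + r0%:R + 25 * kap j * k%:R <= k%:R
    & (2 * r0 <= k)%N].

Lemma card_mul_le (R : realFieldType) (T : finType) (A : {set T}) (f : T -> R) c : (forall u, u \in A -> c <= f u) ->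
  #|A|%:R * c <= \sum_(u in A) f u.
Proof. by move=> fc; rewrite mulr_natl -sumr_const; apply: ler_sum. Qed.

Lemma sum_subset_le (R : realFieldType) (T : finType) (A B : {set T}) (f : T -> R) : A \subset B -> (forall u, u \in B -> 0 <= f u) ->
  \sum_(u in A) f u <= \sum_(u in B) f u.
Proof.
move=> AB f0; rewrite (sum_setD f AB) lerDl; apply: sumr_ge0 => u.
by rewrite inE => /andP[_]; apply: f0.
Qed.

(* The block [B] removed by the greedy choice [v] is nearly constant, so an edge inside [B]
   is worth two vertices of value about [w], instead of one of value [w] and one of value [a]. *)
Lemma dual_edge (R : realFieldType) (T : finType) (e : rel T)
    (esym : symmetric e) (eirr : irreflexive e) (V0 L : {set T}) (k D r0 : nat)
    (L_adj : forall x y, x \in L -> y \in L -> x != y -> e x y)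
    (degP : forall v, v \in V0 -> v \notin L -> (#|V0 :\: adj e v| <= D)%N)
    (kap : nat -> R) (kD : (k <= D)%N) (k2 : (2 <= k)%N) (s0 : nat) (g : T -> R) (V N B : {set T}) j (w a beta E : R) :
  robust e V0 k D r0 kap s0 -> (0 < j < r0)%N -> V \subset V0 ->
  (j.+1 * k <= #|V| + (r0 - j.+1) * (D - k))%N ->
  N \subset V -> B = V :\: N -> (#|B| <= D)%N -> (forall u, u \in V -> g u <= w) -> 0 <= w - a ->
  beta = \sum_(u in N) `|g u - a| -> E = \sum_(u in B) (w - g u) ->
  (k%:R - #|B|%:R) * (w - a) + E + kap j * beta < kap j.+1 * (beta + #|B|%:R * (w - a) + E) ->
  exists K : {set T}, [/\ K \subset V, #|K| = j.+1, clique e K,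
    j.+1%:R * a + 11 / 8 * (w - a) <= \sum_(u in K) g u &
    beta + #|B|%:R * (w - a) + kap j.+1 * (beta + #|B|%:R * (w - a) + E) <= 11 / 8 * (w - a) * k%:R].
Proof.
move=> [redge rkap rD rs0 rk] /andP[j0 jr] VV0 cV NV defB BD gw wa0 defbeta defE lt.
have [kj01 kj2] := rkap j; have [kl01 _] := rkap j.+1.
have rD' := rD _ jr; have rs := rs0 j.+1.
have r1 : (1 <= r0)%N by apply: leq_trans jr.
have BV : B \subset V by rewrite defB subsetDl.
have BDR : #|B|%:R <= D%:R :> R by rewrite ler_nat.
have kDR : k%:R <= D%:R :> R by rewrite ler_nat.
have r1R : 1 <= r0%:R :> R by rewrite ler1n.
have k0 : 2 <= k%:R :> R by rewrite ler_nat.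
have rkR : 2 * r0%:R <= k%:R :> R by rewrite -natrM ler_nat.
have beta0 : 0 <= beta by rewrite defbeta; apply: sumr_ge0.
have E0 : 0 <= E by rewrite defE; apply: sumr_ge0 => u uB; rewrite subr_ge0 gw // (subsetP BV).
have gwB u : u \in B -> g u <= w by move=> uB; rewrite gw // (subsetP BV).
have [|[om0 E1 beta1 bbig numeric] bk] := dual_edge_num kj01 kl01 kj2 r1R k0 kDR rD' _ wa0 beta0 E0 lt.
  by rewrite ler0n.
have wE : w = a + (w - a) by ring.
move: (w - a) wE om0 E1 beta1 numeric {lt wa0} => om wE om0 E1 beta1 numeric.
have /andP[kl0 kl1] := kl01.
have kom0 : 0 < k%:R * om by apply: mulr_gt0 => //; apply: lt_le_trans k0.
(* By the bound on [E], few vertices of the block fall below this threshold, and at least [s0 + r0]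
   of them remain. *)
pose B1 := [set u in B | w - om / 4 <= g u].
have B1B : B1 \subset B by apply/subsetP => u; rewrite inE => /andP[].
have cB1 : #|B|%:R <= #|B1|%:R + 88 / 10 * kap j.+1 * k%:R.
  have cE : #|B :\: B1|%:R * (om / 4) <= E.
    rewrite defE; apply: le_trans (card_mul_le _) (sum_subset_le (subsetDl B B1) _) => u.
      rewrite !inE => /andP[+ uB]; rewrite uB /= -ltNge; clear; lra.
    by move=> uB; rewrite subr_ge0 gwB.
  have -> : #|B|%:R = #|B1|%:R + #|B :\: B1|%:R :> R by rewrite -natrD -(cardsID B1 B) (setIidPr B1B).
  have : #|B :\: B1|%:R * om <= 88 / 10 * kap j.+1 * k%:R * om by move: cE E1; clear; lra.
  by rewrite ler_pM2r // lerD2l.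
have cB1' : s0%:R + r0%:R <= #|B1|%:R :> R.
  have : kap j.+1 * #|B|%:R <= kap j.+1 * (101 / 100 * k%:R) by rewrite ler_wpM2l // ltW.
  have : 0 <= kap j.+1 * k%:R by apply: mulr_ge0; [exact: ltW|exact: ler0n].
  by move: rs bbig cB1; clear; lra.
have gB1 u : u \in B1 -> w - om / 4 <= g u by rewrite inE => /andP[].
(* If the clique is found in [L], its [j.+1 >= 2] vertices of weight at least [a + 3 / 4 * om] bring
   [3 / 2 * om], more than the required [11 / 8 * om]. *)
have [lB1|lB1] := leqP j.+1 #|B1 :&: L|.
  have [K KB cK] := subset_of_card lB1; exists K; split=> //.
  - by apply: subset_trans KB _; apply: subset_trans (subsetIl _ _) _; apply: subset_trans BV.
  - apply: (clique_subL L_adj); apply: subset_trans KB (subsetIr _ _).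
  have := @card_mul_le _ _ K g (w - om / 4); rewrite cK => H.
  apply: le_trans (H _) => [|u uK]; last by apply/gB1/(subsetP (subsetIl B1 L))/(subsetP KB).
  have j2 : 2 <= j.+1%:R :> R by rewrite ler_nat.
  have -> : w - om / 4 = a + 3 / 4 * om by rewrite wE; field.
  have : 2 * om <= j.+1%:R * om by rewrite ler_wpM2r // ltW.
  by move: om0; clear; lra.
have B1L : (s0 <= #|B1 :\: L|)%N.
  rewrite -natrD ler_nat in cB1'; rewrite -(leq_add2l #|B1 :&: L|) cardsID.
  by apply: leq_trans cB1'; rewrite addnC leq_add2l; exact: leq_trans (ltnW lB1) jr.
have B1V : B1 :\: L \subset V0.
  by apply: subset_trans (subsetDl _ _) _; apply: subset_trans B1B _; apply: subset_trans BV VV0.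
have [x xB [y yB exy]] := redge _ B1V B1L.
have [xV0 yV0] := (subsetP B1V _ xB, subsetP B1V _ yB).
move: xB yB; rewrite !in_setD => /andP[xL xB1] /andP[yL yB1].
have [xV yV] := (subsetP BV _ (subsetP B1B _ xB1), subsetP BV _ (subsetP B1B _ yB1)).
(* The other [j - 1] vertices are common neighbours of [x] and [y] that fall below [a] by at most
   [om / (8 * r0)] each, hence by [om / 8] in all. The edge brings [3 / 2 * om], and [11 / 8] is the
   difference. *)
pose N1 := V :&: adj e x :&: adj e y.
pose N2 := [set u in N1 | a - om / (8 * r0%:R) <= g u].
have N1V : N1 \subset V by rewrite /N1 -setIA subsetIl.
have N2N1 : N2 \subset N1 by apply/subsetP => u; rewrite inE => /andP[].
have cN1 : (#|V| <= #|N1| + 2 * D)%N.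
  have := card_setI_adj degP xV0 xL VV0.
  have := card_setI_adj degP yV0 yL (subset_trans (subsetIl V (adj e x)) VV0).
  rewrite -/N1; clear; lia.
have cF : #|N1 :\: N2|%:R <= 5 / 100 * k%:R :> R.
  have r8 : 0 < 8 * r0%:R :> R by move: r1R; clear; lra.
  have om8 : om / (8 * r0%:R) <= om by rewrite ler_pdivrMr // ler_peMr ?ltW //; move: r1R; clear; lra.
  have h : #|N1 :\: N2|%:R * (om / (8 * r0%:R)) <= beta + E.
    have fail u : u \in N1 :\: N2 -> u \in V /\ g u < a - om / (8 * r0%:R).
      rewrite inE => /andP[uN2 uN1]; split; first exact: (subsetP N1V).
      by move: uN2; rewrite inE uN1 /= -ltNge.
    have -> : #|N1 :\: N2|%:R = #|(N1 :\: N2) :&: N|%:R + #|(N1 :\: N2) :\: N|%:R :> R.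
      by rewrite -natrD cardsID.
    rewrite mulrDl; apply: lerD.
      rewrite defbeta; apply: le_trans (card_mul_le _) (sum_subset_le (subsetIr _ _) _) => // u.
      rewrite inE => /andP[/fail[_ gu] _]; rewrite ler0_norm; last first.
        have : 0 <= om / (8 * r0%:R) by apply: divr_ge0; apply: ltW.
        by move: gu; clear; lra.
      by move: gu; clear; lra.
    rewrite defE defB; apply: le_trans (card_mul_le _) (sum_subset_le _ _) => [u||u].
    - rewrite inE => /andP[_ /fail[_ gu]]; rewrite wE; move: gu om0; clear; lra.
    - by apply: setSD; apply: subset_trans (subsetDl _ _) N1V.
    - by rewrite inE subr_ge0 => /andP[_ uV]; apply: gw.
  have h2 : #|N1 :\: N2|%:R * om <= 8 * (r0%:R * beta) + 8 * (r0%:R * E).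
    have -> : #|N1 :\: N2|%:R * om = #|N1 :\: N2|%:R * (om / (8 * r0%:R)) * (8 * r0%:R) by rewrite -mulrA divfK // gt_eqF.
    by have := ler_wpM2r (ltW r8) h; clear; lra.
  have h3 : r0%:R * E <= 22 / 10 / 400 / 100 * (k%:R * om).
    have : r0%:R * E <= r0%:R * (22 / 10 * kap j.+1 * (k%:R * om)) by apply: ler_wpM2l => //; apply: le_trans r1R.
    have : kap j.+1 * (400 * r0%:R) * (k%:R * om) <= 1 / 100 * (k%:R * om) by apply: ler_wpM2r; [exact: ltW|move: kj01 kj2; clear; lra].
    by clear; lra.
  have h4 : #|N1 :\: N2|%:R * om <= 5 / 100 * k%:R * om by move: h2 h3 beta1 kom0; clear; lra.
  by rewrite ler_pM2r in h4.
have cN2 : ((j - 1).-1 * D + (j - 1) <= #|N2|)%N.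
  have [j1|j1] := leqP j 1; first by move: j1; rewrite -subn_eq0 => /eqP->.
  rewrite -(ler_nat R).
  have eN : #|N1|%:R = #|N2|%:R + #|N1 :\: N2|%:R :> R by rewrite -natrD -(cardsID N2 N1) (setIidPr N2N1).
  rewrite -(ler_nat R) natrD !natrM in cV; rewrite -(ler_nat R) natrD natrM in cN1; rewrite natrD natrM.
  have e1 : (j - 1).-1%:R = j%:R - 2 :> R by rewrite -subn1 -subnDA natrB //; lia.
  have e2 : (j - 1)%:R = j%:R - 1 :> R by rewrite natrB.
  have e3 : (r0 - j.+1)%:R = r0%:R - j%:R - 1 :> R by rewrite natrB // -natr1; clear; ring.
  have e4 : (D - k)%:R = D%:R - k%:R :> R by rewrite natrB.
  rewrite e1 e2; rewrite e3 e4 -natr1 in cV.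
  have jr' : j%:R + 1 <= r0%:R :> R by rewrite natr1 ler_nat.
  have rD2 : r0%:R * (D%:R - k%:R) <= k%:R / 400 :> R.
    have : kap j.+1 * k%:R <= 1 / 100 * k%:R by apply: ler_wpM2r.
    by move: rD'; clear; lra.
  have kDj : 0 <= (D%:R - k%:R : R) by rewrite subr_ge0.
  by move: cV cN1 eN cF rkR jr' rD2 kDj r1R; clear; lra.
have [K [KN2 cK kK]] := ex_clique esym eirr L_adj degP (subset_trans N2N1 (subset_trans N1V VV0)) cN2.
have KN1 := subset_trans KN2 N2N1.
have Kx : K \subset adj e x by apply: subset_trans KN1 _; rewrite /N1 setIAC; apply: subsetIr.
have Ky : K \subset adj e y by apply: subset_trans KN1 _; apply: subsetIr.
have kyK := cliqueU1 esym kK Ky; have yK := notin_adj eirr Ky.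
have xyK : y |: K \subset adj e x by rewrite subUset Kx sub1set inE exy.
have xK := notin_adj eirr xyK.
exists (x |: (y |: K)); split=> //.
- by rewrite !subUset !sub1set xV yV (subset_trans KN1 N1V).
- by rewrite cardsU1 xK cardsU1 yK cK; case: (j) j0 => // q _; rewrite subn1.
- exact: cliqueU1.
rewrite big_setU1 //= big_setU1 //=.
have gx := gB1 _ xB1; have gy := gB1 _ yB1.
have : (j - 1)%:R * (a - om / (8 * r0%:R)) <= \sum_(u in K) g u.
  by rewrite -cK; apply: card_mul_le => u /(subsetP KN2); rewrite inE => /andP[].
have ejr : (j - 1)%:R * (om / (8 * r0%:R)) <= om / 8.
  have -> : (j - 1)%:R * (om / (8 * r0%:R)) = (j - 1)%:R / r0%:R * (om / 8).
    by field; apply: lt0r_neq0; apply: lt_le_trans r1R.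
  rewrite ler_piMl //; first by apply: divr_ge0; [exact: ltW|exact: ler0n].
  rewrite ler_pdivrMr ?mul1r ?ler_nat; last by apply: lt_le_trans r1R.
  by apply: leq_trans (leq_subr _ _) (ltnW jr).
have e1 : (j - 1)%:R = j.+1%:R - 2 :> R by rewrite natrB // -natr1; ring.
rewrite e1 in ejr *; rewrite wE in gx gy; move: gx gy ejr; clear; lra.
Qed.

(** Bookkeeping common to the two ways of finding the clique: a vertex joined to a clique of its
    neighbourhood, or an edge of the block completed. The cost [m] of capping the weight is paid
    once in the sum and once in the deviations, whence [2 * m]. *)
Lemma dual_step_num (R : realFieldType) (SV AV A1 SN b nN kk gv a beta E K2 m l : R) :
  SV <= SN + (b * gv - E) + m -> AV <= A1 + m -> A1 <= beta + b * (gv - a) + E ->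
  0 <= K2 <= 1 -> 0 <= m -> 0 <= kk -> 0 <= l -> forall SK,
  (exists K1 SK', [/\ SN + (l * kk - nN) * a + K1 * beta - l * (2 * m) <= kk * SK',
    K2 * (beta + b * (gv - a) + E) <= (kk - b) * (gv - a) + E + K1 * beta & gv + SK' <= SK]) \/
  [/\ beta + b * (gv - a) + K2 * (beta + b * (gv - a) + E) <= 11 / 8 * (gv - a) * kk,
    SN <= nN * a + beta, 0 <= E & (l + 1) * a + 11 / 8 * (gv - a) <= SK] ->
  SV + ((l + 1) * kk - (nN + b)) * a + K2 * AV - (l + 1) * (2 * m) <= kk * SK.
Proof.
move=> hS hA hA1 /andP[K20 K21] m0 k0 l0 SK hK.
have hAV : K2 * AV <= K2 * (beta + b * (gv - a) + E) + m.
  have : K2 * AV <= K2 * (beta + b * (gv - a) + E + m) by apply: ler_wpM2l => //; lra.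
  have : K2 * m <= 1 * m by apply: ler_wpM2r.
  by clear; lra.
case: hK => [[K1 [SK' [h1 h2 h3]]]|[h1 h2 h3 h4]].
  have : kk * (gv + SK') <= kk * SK by apply: ler_wpM2l.
  by move: hS hAV h1 h2; clear; lra.
have : kk * ((l + 1) * a + 11 / 8 * (gv - a)) <= kk * SK by apply: ler_wpM2l.
have : 0 <= l * m by apply: mulr_ge0.
by move: hS hAV h1 h2 h3 m0; clear; lra.
Qed.

(* Greedy choice of the heaviest vertex [v] of [V :\: L], followed by induction in its
   neighbourhood, with [g] capped at [g v]: unless [l] vertices of [L] are heavier than [v], and then
   the heaviest of them form the clique, the cap affects fewer than [r0] vertices, which costs at
   most [r0 * M]. *)
Lemma dual (R : realFieldType) (T : finType) (e : rel T)
    (esym : symmetric e) (eirr : irreflexive e) (V0 L : {set T}) (k D r0 : nat)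
    (L_adj : forall x y, x \in L -> y \in L -> x != y -> e x y)
    (degP : forall v, v \in V0 -> v \notin L -> (#|V0 :\: adj e v| <= D)%N)
    (kap : nat -> R) (kapP : forall j, 0 <= kap j <= 1)
    (kD : (k <= D)%N) (k2 : (2 + r0 * (D - k) <= k)%N)
    (rob : (D = k /\ forall j, kap j = 0) \/ exists s0, robust e V0 k D r0 kap s0)
    (l : nat) (V : {set T}) (g : T -> R) (M : R) :
  (0 < l <= r0)%N -> V \subset V0 -> (l * k <= #|V| + (r0 - l) * (D - k))%N ->
  (forall u, 0 <= g u <= M) ->
  exists (K : {set T}) (a : R), [/\ K \subset V, #|K| = l & clique e K] /\
    [/\ 0 <= a, exists2 x, x \in V & a <= g x &
      dual_bound k g V K l a (kap l) (l%:R * (2 * (r0%:R * M)))].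
Proof.
case: l => [//|l]; elim: l V g => [|l IH] V g /andP[_ lr] VV0 cV gM.
  have [x0 x0V] : exists x, x \in V.
    apply/set0Pn; rewrite -cards_eq0 -lt0n.
    have : ((r0 - 1) * (D - k) <= r0 * (D - k))%N by rewrite leq_mul2r leq_subr orbT.
    by move: cV k2; rewrite mul1n; clear; lia.
  have [x xV xm] := ex_max g x0V; exists [set x], (g x); split.
    split; rewrite ?sub1set ?cards1 //; apply/forall_inP => u /set1P->.
    by apply/forall_inP => w /set1P->; rewrite eqxx.
  split; [by case/andP: (gM x)|by exists x|].
  have M0 : 0 <= M by have /andP[] := gM x; apply: le_trans.
  rewrite /dual_bound big_set1.
  have -> : \sum_(u in V) `|g u - g x| = #|V|%:R * g x - \sum_(u in V) g u.
    rewrite mulr_natl -sumr_const -sumrB; apply: eq_bigr => u uV.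
    by rewrite ler0_norm ?opprB // subr_le0 xm.
  have h : 0 <= (1 - kap 1) * (#|V|%:R * g x - \sum_(u in V) g u).
    have /andP[_ K1] := kapP 1; apply: mulr_ge0; first by rewrite subr_ge0.
    by rewrite subr_ge0 mulr_natl -sumr_const; apply: ler_sum.
  have h2 : 0 <= r0%:R * M by apply: mulr_ge0.
  by move: h h2; clear; lra.
have k2' : (2 <= k)%N by apply: leq_trans k2; apply: leq_addr.
have kap01 := kapP l.+2; have M0 (u : T) : 0 <= M by have /andP[] := gM u; apply: le_trans.
have top (Q : {set T}) : Q \subset V :&: L -> (l.+2 <= #|Q|)%N ->
    (forall q w, q \in Q -> w \in V -> w \notin Q -> g w <= g q) ->
    exists (K : {set T}) (a : R), [/\ K \subset V, #|K| = l.+2 & clique e K] /\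
    [/\ 0 <= a, exists2 x, x \in V & a <= g x &
      dual_bound k g V K l.+2 a (kap l.+2) (l.+2%:R * (2 * (r0%:R * M)))].
  move=> QV cQ Qt; have [K [a [KP [a0 ax bd]]]] := dual_top L_adj kap01 k2' (ltn0Sn _) QV cQ Qt gM.
  exists K, a; split=> //; split=> //; apply: le_trans bd; rewrite subr0.
  rewrite gerBl; case: ax => x _ _; apply: mulr_ge0 => //; apply: mulr_ge0 => //.
  by apply: mulr_ge0 => //; apply: M0 x.
have [VL|[v0 v0VL]] := set_0Vmem (V :\: L).
  apply: (top V) => [||q w _ ->] //.
    by rewrite subsetI subxx -setD_eq0 VL eqxx.
  have h1 : ((r0 - l.+2) * (D - k) <= r0 * (D - k))%N by rewrite leq_mul2r leq_subr orbT.
  have h2 : (l.+1 <= l.+1 * k)%N by rewrite leq_pmulr // (leq_trans _ k2').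
  by move: cV k2 h1 h2; rewrite [(l.+2 * k)%N]mulSn; clear; lia.
have [v] := ex_max g v0VL; rewrite inE => /andP[vL vV] vm {v0 v0VL}.
have vmax u : u \in V -> u \notin L -> g u <= g v by move=> uV uL; apply: vm; rewrite inE uL.
pose X := [set x in V | g v < g x].
have XVL : X \subset V :&: L.
  apply/subsetP => u; rewrite !inE => /andP[uV vu]; rewrite uV /=.
  by apply: contraLR vu => uL; rewrite -leNgt vmax.
have XV : X \subset V := subset_trans XVL (subsetIl _ _).
have [lX|lX] := leqP l.+2 #|X|.
  apply: (top X) => // q w; rewrite !inE => /andP[_ vq] wV; rewrite wV /= -leNgt => wv.
  exact: le_trans wv (ltW vq).
have vV0 := subsetP VV0 _ vV; have M0' := M0 v.
pose g1 u := Num.min (g u) (g v).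
have g1M u : 0 <= g1 u <= M.
  have /andP[gu0 guM] := gM u; have /andP[gv0 gvM] := gM v.
  by rewrite le_min gu0 gv0 ge_min guM.
have g1g u : g1 u <= g u by rewrite ge_min lexx.
have g1v u : g1 u <= g v by rewrite ge_min lexx orbT.
have g1E u : u \in V :\: X -> g1 u = g u.
  by rewrite !inE => /andP[+ uV]; rewrite uV /= -leNgt => uv; apply/min_idPl.
pose N := V :&: adj e v; pose B := V :\: N.
have NV : N \subset V by apply: subsetIl.
have BE : B = V :\: adj e v by rewrite /B /N setDIr setDv set0U.
have BD : (#|B| <= D)%N by rewrite BE; apply: leq_trans (degP _ vV0 vL); apply/subset_leq_card/setSD.
have cVNB : #|V| = (#|N| + #|B|)%N by rewrite /B -(cardsID N V) (setIidPr NV).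
(* Up to [D] vertices are lost in place of [k]; the allowance grows by [D - k] when [l] drops by
   one. *)
have cN : (l.+1 * k <= #|N| + (r0 - l.+1) * (D - k))%N.
  have e1 : (r0 - l.+1 = (r0 - l.+2).+1)%N by move: lr; clear; lia.
  move: cV; rewrite e1 cVNB !mulSn; move: BD kD; clear; lia.
have [K [a [[KN cK kK] [a0 [x1 x1N ax] bd]]]] := IH N g1 (ltnW lr) (subset_trans NV VV0) cN g1M.
have av : a <= g v := le_trans ax (g1v x1).
set beta := \sum_(u in N) `|g1 u - a|; pose E := \sum_(u in B) (g v - g1 u).
have defE : \sum_(u in B) g1 u = #|B|%:R * g v - E.
  by rewrite /E sumrB sumr_const mulr_natl opprB addrC subrK.
have E0 : 0 <= E by apply: sumr_ge0 => u _; rewrite subr_ge0.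
have XM : #|X|%:R * M <= r0%:R * M.
  by apply: ler_wpM2r => //; rewrite ler_nat; apply: leq_trans (ltnW lX) lr.
have hS : \sum_(u in V) g u <= \sum_(u in N) g1 u + (#|B|%:R * g v - E) + r0%:R * M.
  rewrite -defE -(sum_setD g1 NV) (sum_setD g XV) (sum_setD g1 XV).
  have -> : \sum_(u in V :\: X) g u = \sum_(u in V :\: X) g1 u by apply: eq_bigr => u /g1E->.
  have : \sum_(u in X) g u <= #|X|%:R * M.
    by rewrite mulr_natl -sumr_const; apply: ler_sum => u _; case/andP: (gM u).
  have : 0 <= \sum_(u in X) g1 u by apply: sumr_ge0 => u _; case/andP: (g1M u).
  by move: XM; clear; lra.
have hA : \sum_(u in V) `|g u - a| <= \sum_(u in V) `|g1 u - a| + r0%:R * M.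
  rewrite (sum_setD (fun u => `|g u - a|) XV) (sum_setD (fun u => `|g1 u - a|) XV).
  have -> : \sum_(u in V :\: X) `|g u - a| = \sum_(u in V :\: X) `|g1 u - a|.
    by apply: eq_bigr => u /g1E->.
  have : \sum_(u in X) `|g u - a| <= \sum_(u in X) (`|g1 u - a| + M).
    apply: ler_sum => u _; apply: le_trans (ler_distD (g1 u) _ _) _; rewrite addrC lerD2l.
    rewrite ger0_norm ?subr_ge0 //; have /andP[_] := gM u; have /andP[] := g1M u.
    by clear; lra.
  rewrite big_split /= sumr_const -mulr_natl; move: XM; clear; lra.
have hA1 : \sum_(u in V) `|g1 u - a| <= beta + #|B|%:R * (g v - a) + E.
  rewrite (sum_setD (fun u => `|g1 u - a|) NV) -addrA lerD2l.
  rewrite mulr_natl -sumr_const /E -big_split /=; apply: ler_sum => u _.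
  have := g1v u; case: (lerP a (g1 u)); move: av; clear; lra.
have cVR : #|V|%:R = #|N|%:R + #|B|%:R :> R by rewrite -natrD cVNB.
have num := @dual_step_num R _ _ _ _ _ #|N|%:R k%:R _ _ _ _ (kap l.+2) _ l.+1%:R hS hA hA1 kap01 _ _ _.
have {}num := num (mulr_ge0 (ler0n _ _) M0') (ler0n _ _) (ler0n _ _).
have gsum (K' : {set T}) : \sum_(u in K') g1 u <= \sum_(u in K') g u by apply: ler_sum.
(* Joining [v] to the clique of [N] works if what is left over by the induction covers the gain
   demanded at [l.+2]. Otherwise the gains are positive, because [#|B| <= k] excludes this case for
   [D = k] and [kap = 0], and [dual_edge] takes over. *)
have [case1|case2] := leP (kap l.+2 * (beta + #|B|%:R * (g v - a) + E))
    ((k%:R - #|B|%:R) * (g v - a) + E + kap l.+1 * beta).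
  have Kv : K \subset adj e v by apply: subset_trans KN (subsetIr _ _).
  exists (v |: K), a; split.
    split; last exact: cliqueU1.
    - by rewrite subUset sub1set vV (subset_trans KN NV).
    - by rewrite cardsU1 (notin_adj eirr Kv) cK.
  split=> //; first by exists v.
  rewrite /dual_bound cVR -[l.+2%:R]natr1; apply: num; left.
  exists (kap l.+1), (\sum_(u in K) g1 u); split=> //.
  by rewrite big_setU1 ?(notin_adj eirr Kv) //= lerD2l.
case: rob => [[Dk kap0]|[s0 robs]].
  have : 0 <= (k%:R - #|B|%:R) * (g v - a).
    by apply: mulr_ge0; rewrite subr_ge0 // ler_nat -Dk.
  move: case2 E0; rewrite !kap0 !mul0r addr0; clear; lra.
have wa0 : 0 <= g v - a by rewrite subr_ge0.
have [K' [K'V cK' kK' sK' nK']] := @dual_edge R T e esym eirr V0 L k D r0 L_adj degP kap kD k2' s0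
  g1 V N B l.+1 (g v) a beta E robs lr VV0 cV NV erefl BD (fun u _ => g1v u) wa0 erefl erefl case2.
exists K', a; split=> //; split=> //; first by exists v.
rewrite /dual_bound cVR -[l.+2%:R]natr1; apply: num; right; split=> //.
- rewrite -lerBlDl mulr_natl -sumr_const -sumrB; apply: ler_sum => u _; exact: ler_norm.
- by rewrite natr1; apply: le_trans sK' (gsum _).
Qed.

(** * The potential *)

(** Expand [(y + x) ^ 4]. The term [4 * y * x ^ 3] is split between its neighbours, which leaves
    [8 * y ^ 2 * x ^ 2 + 3 * x ^ 4]; the mixed term is at most [y ^ 4 / tau + 16 * l ^ 4 * tau] by
    the inequality of the means, and [19 = 16 + 3]. *)
Lemma quartic_step (R : realFieldType) (z x l tau : R) :
  `|x| <= l -> 1 <= tau ->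
  Num.max 0 (z + x) ^+ 4 <= Num.max 0 z ^+ 4 + 4 * (Num.max 0 z ^+ 3 * x)
     + Num.max 0 z ^+ 4 / tau + 19 * l ^+ 4 * tau.
Proof.
move=> xl tau1; set y := Num.max 0 z.
have y0 : 0 <= y by rewrite le_max lexx.
have yz : z <= y by rewrite le_max lexx orbT.
have l0 : 0 <= l := le_trans (normr_ge0 x) xl.
have tau0 : 0 < tau by apply: lt_le_trans tau1.
have up : Num.max 0 (z + x) ^+ 4 <= (y + x) ^+ 4.
  case: (leP 0 (z + x)) => h; last by rewrite expr0n exprn_even_ge0.
  by rewrite lerXn2r ?nnegrE // ?lerD2r //; apply: le_trans h _; rewrite lerD2r.
apply: le_trans up _.
have x2 : x ^+ 2 <= l ^+ 2 by rewrite -[x ^+ 2]real_normK ?num_real // lerXn2r ?nnegrE.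
have x4 : x ^+ 4 <= l ^+ 4.
  by rewrite (exprM x 2 2) (exprM l 2 2) lerXn2r ?nnegrE ?sqr_ge0.
have yx : y ^+ 2 * x ^+ 2 <= y ^+ 2 * l ^+ 2 by apply: ler_wpM2l => //; apply: sqr_ge0.
have h1 : 0 <= (y * x - x ^+ 2) ^+ 2 by apply: sqr_ge0.
have h2 : 8 * (y ^+ 2 * l ^+ 2) <= y ^+ 4 / tau + 16 * l ^+ 4 * tau.
  rewrite -(ler_pM2r tau0) [leRHS]mulrDl divfK ?gt_eqF //.
  have : 0 <= (y ^+ 2 - 4 * l ^+ 2 * tau) ^+ 2 by apply: sqr_ge0.
  by clear; lra.
have h3 : l ^+ 4 <= l ^+ 4 * tau by rewrite ler_peMr // exprn_ge0.
move: h1 h2 h3 x4 yx; clear; lra.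
Qed.

Section Potential.
Variables (R : realFieldType) (T : finType) (e : rel T) (V0 : {set T}) (p : T -> R).

(* [p v] is meant to be the proportion of non-neighbours of [v] in the initial set. *)
Definition excess (U : {set T}) v : R := #|U :\: adj e v|%:R - p v * #|U|%:R.
Definition posexc U v := Num.max 0 (excess U v).
Definition potential U := \sum_(v in V0) posexc U v ^+ 4.
Definition pweight U u := \sum_(v in V0) posexc U v ^+ 3 * (~~ e v u)%:R.
Definition pmass U := \sum_(v in V0) posexc U v ^+ 3.

Lemma posexc_ge0 U v : 0 <= posexc U v.
Proof. by rewrite le_max lexx. Qed.

Lemma pweight_bound U u : 0 <= pweight U u <= pmass U.
Proof.
apply/andP; split.
  by apply: sumr_ge0 => v _; apply: mulr_ge0; rewrite ?ler0n // exprn_ge0 ?posexc_ge0.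
apply: ler_sum => v _; rewrite -[leRHS]mulr1; apply: ler_wpM2l.
  by rewrite exprn_ge0 ?posexc_ge0.
by case: (e v u).
Qed.

Lemma sum_pweight U (X : {set T}) :
  \sum_(u in X) pweight U u = \sum_(v in V0) posexc U v ^+ 3 * #|X :\: adj e v|%:R.
Proof.
rewrite exchange_big /=; apply: eq_bigr => v _; rewrite -mulr_sumr; congr (_ * _).
rewrite -natr_sum; congr (_%:R); rewrite -sum1_card big_mkcond [RHS]big_mkcond /=.
by apply: eq_bigr => u _; rewrite !inE; case: (u \in X); case: (e v u).
Qed.

(** With [z] the positive excess, the first-order change is four times the sum of [z ^ 3] times the
    change of excess. Multiplied by [#|U|], this sum is [l * g(U) - #|U| * g(X)] minus [l] times the
    sum of [z ^ 4], for [g = pweight]. By hypothesis it is at most the sum of [z ^ 3 * (C - l * z)],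
    whose terms never exceed [C ^ 4]. *)
Lemma potential_step (U X : {set T}) (l : nat) (C tau : R) :
  (forall v, v \in V0 -> 0 <= p v <= 1) -> X \subset U -> #|X| = l -> (0 < l)%N -> 0 <= C -> 1 <= tau ->
  l%:R * \sum_(u in U) pweight U u - C * pmass U <= #|U|%:R * \sum_(u in X) pweight U u ->
  potential (U :\: X) <= potential U * (1 + tau^-1) + #|V0|%:R * (4 * C ^+ 4 + 19 * l%:R ^+ 4) * tau.
Proof.
move=> p01 XU cX l0 C0 tau1 good.
pose x v := p v * l%:R - #|X :\: adj e v|%:R.
have excD v : excess (U :\: X) v = excess U v + x v.
  rewrite /excess /x.
  have -> : #|U|%:R = l%:R + #|U :\: X|%:R :> R by rewrite -natrD -(cardsID X U) (setIidPr XU) cX.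
  have -> : #|U :\: adj e v|%:R = #|X :\: adj e v|%:R + #|U :\: X :\: adj e v|%:R :> R.
    rewrite -natrD -(cardsID X (U :\: adj e v)); congr ((_ + _)%:R).
      by apply: eq_card => u; rewrite !inE; case: (boolP (u \in X)) => [/(subsetP XU)->|_]; rewrite ?andbT ?andbF.
    by apply: eq_card => u; rewrite !inE andbCA.
  by ring.
have xl v : v \in V0 -> `|x v| <= l%:R.
  move=> /p01/andP[p0 p1]; have h0 : 0 <= l%:R :> R by apply: ler0n.
  have h1 : #|X :\: adj e v|%:R <= l%:R :> R by rewrite ler_nat -cX; apply/subset_leq_card/subsetDl.
  have h2 : 0 <= #|X :\: adj e v|%:R :> R by apply: ler0n.
  have h3 : p v * l%:R <= l%:R by apply: ler_piMl.
  have h4 : 0 <= p v * l%:R by apply: mulr_ge0.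
  rewrite ler_norml /x; move: h1 h2 h3 h4; clear; lra.
have U1 : 1 <= #|U|%:R :> R by rewrite ler1n; apply: leq_trans l0 _; rewrite -cX subset_leq_card.
have lin : \sum_(v in V0) posexc U v ^+ 3 * x v <= #|V0|%:R * C ^+ 4.
  have eqs : #|U|%:R * \sum_(v in V0) posexc U v ^+ 3 * x v =
     \sum_(v in V0) posexc U v ^+ 3 * (C - l%:R * excess U v) - C * pmass U
     + l%:R * \sum_(u in U) pweight U u - #|U|%:R * \sum_(u in X) pweight U u.
    rewrite !sum_pweight /pmass !mulr_sumr -!sumrB -big_split /= -sumrB.
    by apply: eq_bigr => v _; rewrite /x /excess; ring.
  have h1 : \sum_(v in V0) posexc U v ^+ 3 * (C - l%:R * excess U v) <= #|V0|%:R * C ^+ 4.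
    rewrite mulr_natl -sumr_const; apply: ler_sum => v _.
    rewrite /posexc; case: (leP 0 (excess U v)) => [z0|_]; last first.
      by rewrite expr0n mul0r exprn_ge0.
    move: (excess U v) z0 => z z0.
    have [Cz|zC] := leP C z.
      apply: (@le_trans _ _ 0); last exact: exprn_ge0.
      apply: mulr_ge0_le0; first exact: exprn_ge0.
      by rewrite subr_le0; apply: le_trans Cz _; rewrite ler_peMl // ler1n.
    apply: (@le_trans _ _ (z ^+ 3 * C)).
      by apply: ler_wpM2l; rewrite ?exprn_ge0 // gerBl mulr_ge0.
    by rewrite [C ^+ 4]exprSr; apply: ler_wpM2r => //; rewrite lerXn2r ?nnegrE // ltW.
  set Q := \sum_(v in V0) _ in eqs *; have [Q0|Q0] := leP Q 0.
    by apply: le_trans Q0 _; apply: mulr_ge0; rewrite ?ler0n // exprn_ge0.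
  apply: (@le_trans _ _ (#|U|%:R * Q)); first by rewrite ler_peMl // ltW.
  by rewrite eqs; move: h1 good; clear; lra.
have tau0 : 0 <= tau by apply: le_trans tau1.
have -> : potential (U :\: X) = \sum_(v in V0) Num.max 0 (excess U v + x v) ^+ 4.
  by apply: eq_bigr => v _; rewrite /posexc excD.
apply: le_trans (ler_sum _ (fun v vV => quartic_step (excess U v) (xl v vV) tau1)) _.
rewrite !big_split /= -mulr_sumr -mulr_suml sumr_const -/(potential U) -[in leLHS]mulr_natl.
have : #|V0|%:R * C ^+ 4 <= #|V0|%:R * C ^+ 4 * tau.
  by rewrite ler_peMr //; apply: mulr_ge0; [exact: ler0n|exact: exprn_ge0].
by move: lin; rewrite /posexc; clear; lra.
Qed.

(** With [tau = i.+1 = I] the recursion closes, because [I ^ 2 * (1 + 1 / I) + I <= (I + 1) ^ 2].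
    Over at most [n] steps the potential is thus of order [n ^ 3], and each excess of order
    [n ^ (3/4)]. *)
Lemma potential_iter (U X : {set T}) (l i : nat) (C : R) :
  (forall v, v \in V0 -> 0 <= p v <= 1) -> X \subset U -> #|X| = l -> (0 < l)%N -> 0 <= C ->
  l%:R * \sum_(u in U) pweight U u - C * pmass U <= #|U|%:R * \sum_(u in X) pweight U u ->
  potential U <= (4 * C ^+ 4 + 19 * l%:R ^+ 4) * #|V0|%:R * i.+1%:R ^+ 2 ->
  potential (U :\: X) <= (4 * C ^+ 4 + 19 * l%:R ^+ 4) * #|V0|%:R * i.+2%:R ^+ 2.
Proof.
move=> p01 XU cX l0 C0 good; set A := 4 * _ + _ => hU.
have A0 : 0 <= A by apply: addr_ge0; apply: mulr_ge0; rewrite ?exprn_ge0 ?ler0n.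
have i1 : 1 <= i.+1%:R :> R by rewrite ler1n.
apply: le_trans (potential_step p01 XU cX l0 C0 i1 good) _; rewrite -/A.
have i0 : 0 < i.+1%:R :> R by rewrite ltr0n.
have h : potential U * (1 + i.+1%:R^-1) <= A * #|V0|%:R * i.+1%:R ^+ 2 * (1 + i.+1%:R^-1).
  by apply: ler_wpM2r => //; apply: addr_ge0 => //; rewrite invr_ge0 ltW.
have e2 : i.+1%:R ^+ 2 * (1 + i.+1%:R^-1) = i.+1%:R ^+ 2 + i.+1%:R :> R.
  by rewrite mulrDr mulr1 expr2 mulfK ?gt_eqF.
have e3 : i.+2%:R = i.+1%:R + 1 :> R by rewrite -natr1.
have h0 : 0 <= A * #|V0|%:R by apply: mulr_ge0.
rewrite -[leRHS]mulrA e2 in h; rewrite e3.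
have gen (P I N B : R) : P <= B * N * (I ^+ 2 + I) -> 0 <= B * N -> P + N * B * I <= B * N * (I + 1) ^+ 2.
  by clear; lra.
by rewrite -mulrA [X in _ + X]mulrA; apply: gen.
Qed.

Lemma excess_le (U : {set T}) v (y : R) : v \in V0 -> 0 <= y -> potential U <= y ^+ 4 -> excess U v <= y.
Proof.
move=> vV y0 hy; have : posexc U v ^+ 4 <= y ^+ 4.
  apply: le_trans hy; rewrite /potential (bigD1 v) //= lerDl; apply: sumr_ge0 => w _.
  by rewrite exprn_ge0 ?posexc_ge0.
rewrite ler_pXn2r ?nnegrE ?posexc_ge0 //; apply: le_trans.
by rewrite le_max lexx orbT.
Qed.

End Potential.

(** * Almost factors *)

Lemma factor_setD (T : finType) (e : rel T) r (V U X : {set T}) : U \subset V -> X \subset U ->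
  factor e r (V :\: U) -> factor e r X -> factor e r (V :\: (U :\: X)).
Proof.
move=> UV XU fU fX; rewrite (_ : V :\: (U :\: X) = (V :\: U) :|: X).
  apply: factorU => //; rewrite -setI_eq0; apply/eqP/setP => u; rewrite !inE.
  by case: (boolP (u \in X)) => [/(subsetP XU)->|_]; rewrite ?andbF.
apply/setP => u; rewrite !inE.
case: (boolP (u \in X)) => [uX|_]; last by rewrite orbF.
by rewrite (subsetP UV) ?(subsetP XU) ?orbT.
Qed.

Section AlmostFactor.
Variables (R : realFieldType) (T : finType) (e : rel T) (V0 : {set T}) (r K kmin : nat) (theta : R).
Hypotheses (esym : symmetric e) (eirr : irreflexive e).
Hypotheses (r0 : (0 < r)%N) (cV0 : #|V0| = (r * K)%N) (kmin2 : (2 <= kmin)%N) (theta0 : 0 < theta).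
Hypothesis oreP : forall x y, x \in V0 -> y \in V0 -> x != y -> ~~ e x y ->
  #|V0 :\: adj e x|%:R + #|V0 :\: adj e y|%:R <= 2 * (1 - theta) * K%:R :> R.

(** The error [2 * r ^ 2 * M] of [dual] for cliques of size [r], times [r] because the potential
    needs the factor [#|U| = r * k] in place of [k]. *)
Let C : R := 2 * r%:R ^+ 3.
Let A : R := 4 * C ^+ 4 + 19 * r%:R ^+ 4.
Hypothesis bigP : A * (r * K)%:R * (K.+1)%:R ^+ 2 <= (theta * kmin%:R) ^+ 4.

Let p v : R := #|V0 :\: adj e v|%:R / #|V0|%:R.

(** While more than [r * kmin] vertices remain, [bigP] keeps every excess below [theta * k]. The
    slack [theta] of the Ore condition makes up for it, so the vertices with more than [k]
    non-neighbours in [U] form a clique, and [dual] without gain provides the next tile. *)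
Lemma almost_factor_iter t : (t + kmin <= K)%N -> exists U : {set T},
  [/\ U \subset V0, #|U| = (r * (K - t))%N, factor e r (V0 :\: U) &
      potential e V0 p U <= A * #|V0|%:R * t.+1%:R ^+ 2].
Proof.
have r1 : 1 <= r%:R :> R by rewrite ler1n.
have C0 : 0 <= C by apply: mulr_ge0 => //; apply: exprn_ge0.
have A0 : 0 <= A by apply: addr_ge0; apply: mulr_ge0; rewrite ?exprn_ge0.
elim: t => [|t IH] tK.
  exists V0; split; rewrite ?setDv ?factor0 ?subn0 //.
  rewrite (_ : potential _ _ _ _ = 0) ?mulr_ge0 ?exprn_ge0 //.
  apply: big1 => v _; rewrite /posexc /excess /p divfK ?subrr ?maxxx ?expr0n //.
  by rewrite cV0 pnatr_eq0 muln_eq0 negb_or -!lt0n r0; move: tK kmin2; clear; lia.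
have [|U [UV cU fU pU]] := IH; first by apply: leq_trans (ltnW _) tK; rewrite addSn.
set k := (K - t)%N in cU.
have kk : (kmin < k)%N by move: tK; rewrite /k; clear; lia.
have k0 : 0 < k%:R :> R by rewrite ltr0n; apply: leq_ltn_trans kk.
have kK : (k <= K)%N by apply: leq_subr.
have K0 : 0 < K%:R :> R by rewrite ltr0n; apply: leq_trans kK; apply: leq_ltn_trans kk.
have rn0 : r%:R != 0 :> R by rewrite gt_eqF // (lt_le_trans ltr01).
have excle v : v \in V0 -> #|U :\: adj e v|%:R <= #|V0 :\: adj e v|%:R / K%:R * k%:R + theta * k%:R.
  move=> vV; have tk0 : 0 <= theta * k%:R by apply: mulr_ge0; apply: ltW.
  have : potential e V0 p U <= (theta * k%:R) ^+ 4.
    apply: le_trans pU _; apply: (@le_trans _ _ ((theta * kmin%:R) ^+ 4)).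
      apply: le_trans bigP; rewrite cV0; apply: ler_wpM2l; first by apply: mulr_ge0.
      by rewrite lerXn2r ?nnegrE // ler_nat; move: tK; clear; lia.
    by rewrite lerXn2r ?nnegrE ?mulr_ge0 ?(ltW theta0) // ler_wpM2l ?(ltW theta0) // ler_nat ltnW.
  move=> /(excess_le vV tk0); rewrite /excess /p cV0 cU !natrM lerBlDl.
  by congr (_ <= _ + _); field; rewrite rn0 gt_eqF.
pose L := [set v in U | (k < #|U :\: adj e v|)%N].
have L_adj x y : x \in L -> y \in L -> x != y -> e x y.
  rewrite !inE => /andP[xU xk] /andP[yU yk] xy; apply/negPn/negP => nxy.
  have xV := subsetP UV _ xU; have yV := subsetP UV _ yU.
  have o := oreP xV yV xy nxy.
  have : (#|V0 :\: adj e x|%:R + #|V0 :\: adj e y|%:R) / K%:R * k%:R <= 2 * (1 - theta) * k%:R.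
    apply: ler_wpM2r; first exact: ltW.
    by rewrite ler_pdivrMr.
  move: xk yk (excle _ xV) (excle _ yV); rewrite -!(ltr_nat R); lra.
have degP v : v \in U -> v \notin L -> (#|U :\: adj e v| <= k)%N by move=> vU; rewrite inE vU -leqNgt.
have k2 : (2 + r * (k - k) <= k)%N.
  by rewrite subnn muln0 addn0; apply: leq_trans kmin2 (ltnW kk).
have [|||Q [a [[QU cQ kQ] [a0 _ bd]]]] := @dual R T e esym eirr U L k k r L_adj degP
    (fun=> 0) _ (leqnn k) k2 (or_introl (conj erefl (fun=> erefl))) r U (pweight e V0 p U) (pmass e V0 p U)
    _ (subxx _) _ (pweight_bound e V0 p U).
- by move=> _; rewrite lexx ler01.
- by rewrite r0 leqnn.
- by rewrite cU leq_addr.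
exists (U :\: Q); split.
- by apply: subset_trans (subsetDl _ _) UV.
- by rewrite cardsD (setIidPr QU) cU cQ -{2}[r]muln1 -mulnBr -subnDA addn1.
- by apply: factor_setD => //; apply: factor_clique.
apply: potential_iter QU cQ r0 C0 _ pU.
  move=> v vV; apply/andP; split; first by apply: divr_ge0.
  rewrite /p; have [->|V00] := eqVneq #|V0| 0%N; first by rewrite invr0 mulr0.
  by rewrite ler_pdivrMr ?ltr0n ?lt0n // mul1r ler_nat subset_leq_card // subsetDl.
move: bd; rewrite /dual_bound cU natrM subrr !mul0r !addr0 => bd.
have := ler_wpM2l (ler0n R r) bd; rewrite /C; lra.
Qed.

Lemma almost_factor : (kmin <= K)%N -> exists U : {set T},
  [/\ U \subset V0, #|U| = (r * kmin)%N & factor e r (V0 :\: U)].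
Proof.
move=> kK; have [|U [UV cU fU _]] := @almost_factor_iter (K - kmin)%N; first by rewrite subnK.
by exists U; split=> //; rewrite cU subKn.
Qed.

End AlmostFactor.

(** * Adding universal vertices *)

Section Universal.
Variables (T : finType) (e : rel T) (m : nat).

(* [e] with [m] universal vertices added. *)
Definition cone (x y : T + 'I_m) : bool :=
  match x, y with
  | inl a, inl b => e a b
  | inr i, inr j => i != j
  | _, _ => true
  end.

Lemma cone_sym : symmetric e -> symmetric cone.
Proof. by move=> es [x|i] [y|j] //=; rewrite eq_sym. Qed.

Lemma cone_irr : irreflexive e -> irreflexive cone.
Proof. by move=> ei [x|i] /=; rewrite ?eqxx. Qed.

Definition cone_set (U : {set T}) : {set T + 'I_m} :=
  [set z | match z with inl x => x \in U | inr _ => true end].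

Lemma card_cone_set U : #|cone_set U| = (#|U| + m)%N.
Proof.
rewrite (_ : cone_set U = [set inl x | x in U] :|: [set inr i | i : 'I_m]); last first.
  apply/setP => [[x|i]]; rewrite !inE.
    rewrite mem_imset; last by move=> a b [].
    by rewrite (_ : (_ \in [set _ | _ in _]) = false) ?orbF //; apply/imsetP => -[].
  by rewrite [X in _ || X]imset_f // orbT.
rewrite cardsU (_ : _ :&: _ = set0) ?cards0 ?subn0.
  by rewrite !card_imset ?cardT ?size_enum_ord // => a b [].
apply/setP => [[x|i]]; rewrite !inE; apply/andP => -[]; [move=> _|]; by case/imsetP.
Qed.

Lemma cone_set_nonadj U x : #|cone_set U :\: adj cone (inl x)| = #|U :\: adj e x|.
Proof.
rewrite -(card_imset (U :\: adj e x) (f := @inl T 'I_m)); last by move=> a b [].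
apply: eq_card => -[y|i]; rewrite !inE /=.
  by rewrite mem_imset ?inE // => a b [].
by apply/esym/negbTE/imsetP => -[].
Qed.

(** At most [m] tiles contain an added vertex; they are dissolved, and their vertices in [U] join
    the leftover. *)
Lemma factor_cone r (U : {set T}) (U' : {set T + 'I_m}) : (0 < r)%N -> U' \subset cone_set U ->
  factor cone r (cone_set U :\: U') ->
  exists Z : {set T}, [/\ Z \subset U, (#|Z| <= #|U'| + r * m)%N & factor e r (U :\: Z)].
Proof.
move=> r0 U'U /factorP[P [partP cP]]; have [/eqP covP trivP n0P] := and3P partP.
pose Q := [set A in P | [exists i, inr i \in A]].
have cQ : (#|Q| <= m)%N.
  apply: (@leq_trans #|[set pblock P (inr i) | i : 'I_m]|); last first.
    by apply: leq_trans (leq_imset_card _ _) _; rewrite cardT size_enum_ord.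
  apply: subset_leq_card; apply/subsetP => A; rewrite inE => /andP[AP /existsP[i iA]].
  by apply/imsetP; exists i => //; rewrite (def_pblock trivP AP iA).
have QP : Q \subset P by apply/subsetP => A; rewrite inE => /andP[].
pose Z := [set x in U | (inl x \in U') || (inl x \in cover Q)].
exists Z; split.
- by apply/subsetP => x; rewrite inE => /andP[].
- rewrite -(card_imset Z (f := @inl T 'I_m)); last by move=> a b [].
  apply: (@leq_trans #|U' :|: cover Q|).
    apply: subset_leq_card; apply/subsetP => z /imsetP[x]; rewrite inE => /andP[_ h] ->.
    by rewrite inE.
  apply: leq_trans (leq_card_setU _ _) _; rewrite leq_add2l.
  apply: leq_trans (leq_card_cover _) _.
  rewrite (eq_bigr (fun=> r)); last by move=> A /(subsetP QP)/cP[].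
  by rewrite sum_nat_const mulnC leq_mul2l cQ orbT.
pose f (A : {set T + 'I_m}) : {set T} := [set x | inl x \in A].
have finl A : A \in P :\: Q -> forall z, z \in A -> exists2 x, z = inl x & x \in f A.
  rewrite !inE => /andP[+ AP] [x|i] zA; first by exists x; rewrite ?inE.
  by rewrite AP /= => /existsP[]; exists i.
have cf A : A \in P :\: Q -> #|f A| = r.
  move=> AP; have [<- _] := cP A (subsetP (subsetDl P Q) _ AP).
  rewrite -(card_imset (f A) (f := @inl T 'I_m)); last by move=> a b [].
  apply: eq_card => z; apply/imsetP/idP => [[x xA ->]|zA]; first by rewrite inE in xA.
  by have [x -> xA] := finl A AP z zA; exists x.
apply/factorP; exists (f @: (P :\: Q)); split; last first.
  move=> B /imsetP[A AP ->]; split; first exact: cf.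
  have [_ /forall_inP kA] := cP A (subsetP (subsetDl P Q) _ AP).
  apply/forall_inP => x; rewrite inE => /kA/forall_inP kx; apply/forall_inP => y; rewrite inE.
  by move=> /kx.
apply/and3P; split.
- apply/eqP/setP => x; apply/bigcupP/idP.
    move=> [B /imsetP[A AP ->]]; rewrite inE => xA.
    have AP' := subsetP (subsetDl P Q) _ AP.
    have : inl x \in cover P by apply/bigcupP; exists A.
    rewrite covP !inE => /andP[xU' xU]; rewrite xU (negbTE xU') /= andbT.
    apply/negP => /bigcupP[A' A'Q xA']; have A'P := subsetP QP _ A'Q.
    have AA' : A = A' by rewrite -(def_pblock trivP AP' xA) -(def_pblock trivP A'P xA').
    by move: AP; rewrite in_setD AA' A'Q.
  rewrite !inE => /andP[+ xU]; rewrite xU /= negb_or => /andP[xU' xQ].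
  have : inl x \in cover P by rewrite covP !inE xU' xU.
  case/bigcupP => A AP xA; exists (f A); last by rewrite inE.
  apply/imset_f; rewrite in_setD AP andbT; apply: contra xQ => AQ.
  by apply/bigcupP; exists A.
- apply/trivIsetP => B1 B2 /imsetP[A1 A1P ->] /imsetP[A2 A2P ->] neq.
  have A12 : A1 != A2 by apply: contra neq => /eqP->.
  have [A1P' A2P'] := (subsetP (subsetDl P Q) _ A1P, subsetP (subsetDl P Q) _ A2P).
  have := trivIsetP trivP A1 A2 A1P' A2P' A12.
  rewrite -!setI_eq0 => /eqP/setP d; apply/eqP/setP => x.
  by have := d (inl x); rewrite !inE.
- by apply/imsetP => -[A AP fA]; have := cf A AP; rewrite -fA cards0; move: r0; case: (r).
Qed.

End Universal.

(** With [r * h] universal vertices [k] becomes [k + h], while the numbers of non-neighbours in [U]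
    stay the same; a deficit in the Ore condition thus turns into the slack [theta]. *)
Lemma leftover_factor (R : realFieldType) (T : finType) (e : rel T) (U : {set T})
    (r k h kmin : nat) (theta : R) :
  symmetric e -> irreflexive e -> (0 < r)%N -> #|U| = (r * k)%N -> (2 <= kmin)%N -> 0 < theta < 1 ->
  (1 <= k)%N ->
  (forall x y, x \in U -> y \in U -> x != y -> ~~ e x y ->
    #|U :\: adj e x|%:R + #|U :\: adj e y|%:R <= 2 * (1 - theta) * (k + h)%:R :> R) ->
  (4 * (2 * r%:R ^+ 3) ^+ 4 + 19 * r%:R ^+ 4) * (r * (k + h))%:R * (k + h).+1%:R ^+ 2
    <= (theta * kmin%:R) ^+ 4 -> (kmin <= k + h)%N ->
  exists Z : {set T}, [/\ Z \subset U, (#|Z| <= r * kmin + r * (r * h))%N & factor e r (U :\: Z)].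
Proof.
move=> es ei r0 cU k2 /andP[th0 th1] k1 ore big kk.
have cV : #|cone_set (r * h) U| = (r * (k + h))%N by rewrite card_cone_set cU mulnDr.
have [|U' [U'V cU' fU']] := @almost_factor R _ (cone e (m := r * h)) (cone_set (r * h) U) r (k + h) kmin theta
   (cone_sym es) (cone_irr ei) r0 cV k2 th0 _ big kk.
  move=> [x|i] [y|j] //=; rewrite ?negbK.
    by rewrite !inE !cone_set_nonadj => xU yU xy; apply: ore => //; apply: contra xy => /eqP->.
  by move=> _ _ + /eqP ij; rewrite ij eqxx.
by have [Z [ZU cZ fZ]] := factor_cone r0 U'V fU'; exists Z; rewrite -cU'.
Qed.

(** * Choosing the absorbers *)

(** Averaging for two requirements at once. If each [s] failed one of them, [h s] would be less than
    [N / (2 * size S) * Phi + Phi * N / (2 * B) * F s], and each of the two parts sums to at most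
    [N * Phi / 2] over [S]. *)
Lemma pick_pos (R : realFieldType) (A : eqType) (S : seq A) (h F : A -> R) (Phi N B : R) :
  0 < Phi -> 0 < N -> 0 < B ->
  (forall s, s \in S -> h s <= Phi) -> (forall s, s \in S -> 0 <= F s) ->
  N * Phi <= \sum_(s <- S) h s -> \sum_(s <- S) F s <= B ->
  exists2 s, s \in S & N / (2 * (size S)%:R) * Phi <= h s /\ F s <= 2 * B / N.
Proof.
move=> Phi0 N0 B0 hPhi F0 hS FS.
have S0 : 0 < (size S)%:R :> R.
  rewrite ltr0n lt0n size_eq0; apply/eqP => SE; move: hS; rewrite SE big_nil leNgt.
  by rewrite mulr_gt0.
pose good s := (N / (2 * (size S)%:R) * Phi <= h s) && (F s <= 2 * B / N).
have [/hasP[s sS /andP[h1 h2]]|/hasPn bad] := boolP (has good S); first by exists s.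
exfalso.
pose f s := N / (2 * (size S)%:R) * Phi + Phi * (N / (2 * B)) * F s.
have c0 : 0 <= Phi * (N / (2 * B)).
  by apply: mulr_ge0; [exact: ltW|apply: divr_ge0; rewrite ?mulr_ge0 // ltW].
have lt s : s \in S -> h s < f s.
  move=> sS; have := bad s sS; rewrite negb_and -!ltNge => /orP[h1|h1].
    by apply: lt_le_trans h1 _; rewrite lerDl; apply: mulr_ge0 => //; apply: F0.
  apply: le_lt_trans (hPhi s sS) _.
  have -> : Phi = Phi * (N / (2 * B)) * (2 * B / N) by field; rewrite !gt_eqF.
  apply: (@lt_le_trans _ _ (Phi * (N / (2 * B)) * F s)).
    by rewrite ltr_pM2l // mulr_gt0 // divr_gt0 // mulr_gt0.
  by rewrite lerDr; apply: mulr_ge0; [apply: divr_ge0; rewrite ?mulr_ge0 ?ler0n // ltW|exact: ltW].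
have sumlt : \sum_(s <- S) h s < \sum_(s <- S) f s.
  have [s sS] : exists s, s \in S.
    by case: (S) S0 => [|s S']; [rewrite ltxx|exists s; apply: mem_head].
  rewrite !(big_rem s sS) /=; apply: ltr_leD; first exact: lt.
  rewrite big_seq [leRHS]big_seq; apply: ler_sum => t tS; exact/ltW/lt/(mem_rem tS).
have : \sum_(s <- S) f s <= N * Phi.
  rewrite /f big_split /= big_const_seq count_predT iter_addr_0 -mulr_sumr.
  have -> : N * Phi = N / (2 * (size S)%:R) * Phi *+ size S + Phi * (N / (2 * B)) * B.
    by rewrite -mulr_natr; field; rewrite !gt_eqF.
  by rewrite lerD2l; apply: ler_wpM2l.
by rewrite leNgt (le_lt_trans hS sumlt).
Qed.

Lemma pick_good (R : realFieldType) (A : eqType) (S : seq A) (h F : A -> R) (Phi N B : R) :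
  0 < Phi -> 0 < N ->
  (forall s, s \in S -> h s <= Phi) -> (forall s, s \in S -> 0 <= F s) ->
  N * Phi <= \sum_(s <- S) h s -> \sum_(s <- S) F s <= B ->
  exists2 s, s \in S & N / (2 * (size S)%:R) * Phi <= h s /\ F s <= 2 * B / N.
Proof.
move=> Phi0 N0 hPhi F0 hS FS.
have FB s : s \in S -> F s <= B.
  move=> sS; apply: le_trans FS; rewrite (big_rem s sS) /= lerDl big_seq.
  by apply: sumr_ge0 => t tS; apply/F0/(mem_rem tS).
(* If [B <= 0], then [F] vanishes on [S] and only [h] matters. *)
have [B0|B0] := leP B 0; last exact: pick_pos.
have [||s sS [h1 _]] := @pick_pos R A S h (fun=> 0) Phi N 1 Phi0 N0 ltr01 hPhi _ hS _ => //.
  by rewrite big1.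
exists s => //; split=> //; have Bs := FB s sS.
have B1 : B = 0 by apply/eqP; rewrite eq_le B0 (le_trans (F0 s sS) Bs).
by move: Bs; rewrite B1 mulr0 mul0r.
Qed.

Lemma sum_setU (R : realFieldType) (T : finType) (A B : {set T}) (f : T -> R) : [disjoint A & B] ->
  \sum_(u in A :|: B) f u = \sum_(u in A) f u + \sum_(u in B) f u.
Proof.
move=> dAB; rewrite (sum_setD f (subsetUl A B)) setDUl setDv set0U.
by have /setDidPl-> : [disjoint B & A] by rewrite disjoint_sym.
Qed.

Definition cov (T : finType) (fam : seq (seq T)) : {set T} := \bigcup_(s <- fam) seqset s.

Definition wdisj (T : finType) (s t : seq T) := [disjoint seqset s & seqset t].

(** * Supersteps: one absorber and [B] balancing cliques *)

Section Phase1.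
Variables (R : realFieldType) (T : finType) (e : rel T) (r : nat).
Hypotheses (esym : symmetric e) (eirr : irreflexive e) (r3 : (2 < r)%N).
Variables (D s0 c f : nat).
Hypotheses (oreP : ore e D) (edgesP : dense_edges e s0 c) (s0P : (2 * c + r <= s0)%N).
Hypotheses (DP : (c + f <= D)%N) (roomP : (s0 + (r - 1) * D + f <= #|T|)%N).
Variables (kap : nat -> R) (k1 : nat).
Hypothesis kapP : forall j, 0 <= kap j <= 1.
Hypothesis robP : forall k, (k1 <= k)%N -> (k * r <= #|T|)%N ->
  [/\ (k <= D)%N, (2 + r * (D - k) <= k)%N & robust e [set: T] k D r kap s0].

Let m := (3 * r ^ 2)%N.
Variables (B : nat) (rho : R).
Let l := (m + B * r)%N.
Hypotheses (rho0 : 0 < rho) (rhoP : rho * #|T|%:R ^+ m <= c%:R ^+ m).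
Hypothesis BP : 4 * m%:R <= B%:R * r%:R * kap r * rho.

(** Up to [l] removed vertices cost [r * l * M] in weight and as much in deviation; the remainder is
    the error of [dual] times [r]. *)
Let C' : R := 2 * r%:R * l%:R + 2 * r%:R ^+ 3.

(** Multiplicative weights in place of a random choice: a set with few absorbers has a large term,
    so a small total serves every [W]. *)
Definition wt fam : R := \sum_(W : {set T} | #|W| == r) (1 / 2) ^+ count (absorbs e r W) fam.

(** The centre [a] given by [dual] changes from clique to clique; the mean is a common centre, at
    the price of a factor two. *)
Lemma sum_dist_mean (U : {set T}) (g : T -> R) a :
  \sum_(u in U) `|g u - (\sum_(w in U) g w) / #|U|%:R| <= 2 * \sum_(u in U) `|g u - a|.
Proof.
have [U0|U0] := eqVneq #|U| 0%N.
  by rewrite (cards0_eq U0) !big_set0 mulr0.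
have U0' : #|U|%:R != 0 :> R by rewrite pnatr_eq0.
set b := _ / _.
have : \sum_(u in U) `|g u - b| <= \sum_(u in U) (`|g u - a| + `|a - b|).
  by apply: ler_sum => u _; apply: ler_distD.
rewrite big_split /= sumr_const => /le_trans; apply.
have -> : `|a - b| *+ #|U| = `|\sum_(u in U) (a - g u)|.
  rewrite sumrB sumr_const -mulr_natl -[X in X * _](ger0_norm (ler0n R #|U|)) -normrM.
  congr (`|_|); rewrite mulrBr mulr_natl; congr (_ - _).
  by rewrite /b mulrC divfK.
rewrite mulr_natl mulr2n lerD2l; apply: le_trans (ler_norm_sum _ _ _) _.
by apply: ler_sum => u _; rewrite distrC.
Qed.

(* The gain term of these [b] cliques outweighs, for [b = B], the loss that the choice of an
   absorber [S] may cause. *)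
Lemma compensate (U S : {set T}) (k : nat) (g : T -> R) (M : R) b :
  #|U| = (r * k)%N -> S \subset U -> #|S| = m -> (b <= B)%N -> (k1 + 3 * r + B <= k)%N ->
  (forall u, 0 <= g u <= M) ->
  exists Y : {set T}, [/\ Y \subset U :\: S, #|Y| = (b * r)%N, factor e r Y &
    b%:R * (r%:R * \sum_(u in U) g u
       + r%:R * kap r / 2 * \sum_(u in U) `|g u - (\sum_(w in U) g w) / #|U|%:R| - C' * M)
    <= #|U|%:R * \sum_(u in Y) g u].
Proof.
move=> cU SU cS; set Lam := \sum_(u in U) `|_|.
elim: b => [|b IH] bB kB gM.
  by exists set0; rewrite sub0set cards0 factor0 big_set0 mulr0 mul0r.
have [Y [YU cY fY bdY]] := IH (ltnW bB) kB gM.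
have r0 : (0 < r)%N by apply: leq_trans r3.
(* As [#|S| = 3 * r ^ 2] is a multiple of [r], the set [V] has [r * k'] vertices and the term in [a]
   of [dual_bound] vanishes. *)
pose V := U :\: S :\: Y; pose k' := (k - 3 * r - b)%N.
have VU : V \subset U by apply: subset_trans (subsetDl _ _) (subsetDl _ _).
have SYU : U = V :|: (S :|: Y).
  apply/setP => u; rewrite !inE; case: (boolP (u \in S)) => [/(subsetP SU)->|uS] /=.
    by rewrite orbT.
  case: (boolP (u \in Y)) => [/(subsetP YU)|]; rewrite ?inE ?uS ?orbF //= => ->; by rewrite orbT.
have cV : #|V| = (r * k')%N.
  rewrite /V cardsD (setIidPr YU) cardsD (setIidPr SU) cU cS cY /k' /m !mulnBr.
  by congr (_ - _ - _)%N; rewrite ?expnS ?expn0 ?muln1; [rewrite mulnCA|rewrite mulnC].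
have k1k' : (k1 <= k')%N by move: kB bB; rewrite /k'; clear; lia.
have k'n : (k' * r <= #|T|)%N by rewrite mulnC -cV max_card.
have [kD k2 rob] := robP k1k' k'n.
have L_adj := low_adj r3 oreP.
have degP v : v \in [set: T] -> v \notin low e D -> (#|[set: T] :\: adj e v| <= D)%N.
  by move=> _; rewrite inE -leqNgt setTD setC_adj.
have [||K [a [[KV cK kK] [a0 [x xV ax] bd]]]] := @dual R T e esym eirr setT (low e D) k' D r
    L_adj degP kap kapP kD k2 (or_intror (ex_intro _ s0 rob)) r V g M _ (subsetT _) _ gM.
- by rewrite r0 leqnn.
- by rewrite cV leq_addr.
have aM : a <= M by apply: le_trans ax _; case/andP: (gM x).
have M0 : 0 <= M := le_trans a0 aM.
have KY : [disjoint Y & K].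
  rewrite disjoint_sym; apply: disjointWl KV _; rewrite -setI_eq0; apply/eqP/setP => u; rewrite !inE.
  by case: (u \in Y); rewrite ?andbF.
have YK : Y :|: K \subset U :\: S.
  by rewrite subUset YU (subset_trans KV) // subsetDl.
exists (Y :|: K); split=> //.
- by rewrite cardsU (disjoint_setI0 KY) cards0 subn0 cY cK mulSn addnC.
- by apply: factorU => //; apply: factor_clique.
rewrite (sum_setU g KY).
suff new : r%:R * \sum_(u in U) g u + r%:R * kap r / 2 * Lam - C' * M <= #|U|%:R * \sum_(u in K) g u.
  rewrite [leRHS]mulrDr -natr1 [leLHS]mulrDl mul1r; exact: lerD.
have lossl (F : T -> R) : (forall u, 0 <= F u <= M) -> \sum_(u in U) F u <= \sum_(u in V) F u + l%:R * M.
  move=> FM; rewrite (sum_setD F VU) lerD2l.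
  apply: (@le_trans _ _ (\sum_(u in S :|: Y) F u)).
    apply: sum_subset_le; last by move=> u _; case/andP: (FM u).
    by apply/subsetP => u; rewrite in_setD => /andP[uV]; rewrite {1}SYU in_setU (negbTE uV).
  apply: (@le_trans _ _ (#|S :|: Y|%:R * M)).
    by rewrite mulr_natl -sumr_const; apply: ler_sum => u _; case/andP: (FM u).
  apply: ler_wpM2r => //; rewrite ler_nat; apply: leq_trans (leq_card_setU _ _) _.
  by rewrite cS cY leq_add2l leq_mul2r (ltnW bB) orbT.
have l1 := lossl g gM.
have l2 : \sum_(u in U) `|g u - a| <= \sum_(u in V) `|g u - a| + l%:R * M.
  apply: lossl => u; rewrite normr_ge0 /= ler_norml.
  by case/andP: (gM u); move: a0 aM; lra.
have l3 : Lam <= 2 * \sum_(u in U) `|g u - a| by apply: sum_dist_mean.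
have /andP[kr0 kr1] := kapP r.
have UV : #|V|%:R * \sum_(u in K) g u <= #|U|%:R * \sum_(u in K) g u.
  apply: ler_wpM2r; first by apply: sumr_ge0 => u _; case/andP: (gM u).
  by rewrite ler_nat subset_leq_card.
apply: le_trans UV; move: bd; rewrite /dual_bound cV natrM subrr mul0r addr0 => bd.
have rR : 0 <= r%:R :> R by apply: ler0n.
have h1 : r%:R * kap r / 2 * Lam <= r%:R * (kap r * (\sum_(u in V) `|g u - a| + l%:R * M)).
  have : kap r * (Lam / 2) <= kap r * (\sum_(u in V) `|g u - a| + l%:R * M).
    by apply: ler_wpM2l => //; move: l2 l3; lra.
  by move=> /(ler_wpM2l rR); lra.
have h2 : r%:R * (kap r * (l%:R * M)) <= r%:R * (1 * (l%:R * M)).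
  by apply: ler_wpM2l => //; apply: ler_wpM2r => //; apply: mulr_ge0.
have h3 := ler_wpM2l rR l1; have h4 := ler_wpM2l rR bd.
by rewrite /C'; move: h1 h2 h3 h4; lra.
Qed.

(** The absorber is chosen both to absorb sets of large total weight [w] and to have a small total
    deviation of [g] from its mean; each set is absorbed by a proportion [rho] of the words, so
    [pick_good] achieves both. The deviation costs at most [2 * m / rho * Lam], which [BP] balances
    against the gain of the [B] cliques. *)
Lemma superstep (U : {set T}) (k : nat) (g : T -> R) (M : R) (w : {set T} -> R) :
  #|U| = (r * k)%N -> (k1 + 3 * r + B <= k)%N -> (#|~: U| + 2 * r + 3 * r ^ 2 <= f)%N ->
  (forall u, 0 <= g u <= M) -> (forall W, 0 <= w W) ->
  0 < \sum_(W : {set T} | #|W| == r) w W ->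
  exists s (Y : {set T}),
    [/\ [/\ uniq s, size s = m, seqset s \subset U & factor e r (seqset s)],
        [/\ Y \subset U :\: seqset s, #|Y| = (B * r)%N & factor e r Y],
        rho / 2 * (\sum_(W : {set T} | #|W| == r) w W) <=
          \sum_(W : {set T} | (#|W| == r) && absorbs e r W s) w W &
        l%:R * \sum_(u in U) g u - B%:R * C' * M <= #|U|%:R * \sum_(u in seqset s :|: Y) g u].
Proof.
move=> cU kB Uf gM w0; set Phi := \sum_(W | _) w W => Phi0.
set gbar := (\sum_(u in U) g u) / #|U|%:R; set Lam := \sum_(u in U) `|g u - gbar|.
have n0 : 0 < #|T|%:R :> R.
  by rewrite ltr0n; move: roomP s0P r3; clear; lia.
have Lam0 : 0 <= Lam by apply: sumr_ge0.
have nm0 : 0 < #|T|%:R ^+ m :> R by apply: exprn_gt0.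
have N0 : 0 < c%:R ^+ m :> R by apply: lt_le_trans rhoP; apply: mulr_gt0.
pose p W s := absorbs e r W s && [disjoint seqset s & ~: U].
pose h s := \sum_(W : {set T} | #|W| == r) w W * (p W s)%:R.
(* Extended by zero, so that the sum over all words is a multiple of [Lam]; words leaving [U] are
   ruled out by [p]. *)
pose G x := if x \in U then `|g x - gbar| else 0.
have G0 x : 0 <= G x by rewrite /G; case: ifP.
have hPhi s : s \in words T m -> h s <= Phi.
  by move=> _; apply: ler_sum => W _; case: (p W s); rewrite ?mulr1 ?mulr0.
have hS : c%:R ^+ m * Phi <= \sum_(s <- words T m) h s.
  rewrite /h exchange_big /= mulr_sumr; apply: ler_sum => W /eqP cW.
  rewrite -mulr_sumr mulrC; apply: ler_wpM2l => //.
  rewrite -natrX -natr_sum ler_nat.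
  have -> : (\sum_(s <- words T m) p W s)%N = count (p W) (words T m).
    by rewrite -sum1_count [RHS]big_mkcond; apply: eq_bigr => s _; case: (p W s).
  have := many_absorbs esym eirr r3 oreP edgesP s0P DP roomP (W := W) (F := ~: U) cW Uf.
  by apply: many_count.
have FS : \sum_(s <- words T m) \sum_(x <- s) G x <= (m * #|T| ^ m.-1)%:R * Lam.
  rewrite sum_words_mem; apply: ler_wpM2l; first exact: ler0n.
  by rewrite /Lam [leRHS]big_mkcond.
have [s sm [hs Fs]] := pick_good Phi0 N0 hPhi (fun s _ => sumr_ge0 _ (fun x _ => G0 x)) hS FS.
rewrite mem_words in sm; have ss := eqP sm; rewrite size_words natrX in hs.
have hs0 : rho / 2 * Phi <= h s.
  apply: le_trans hs; apply: ler_wpM2r; first exact: ltW.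
  rewrite ler_pdivlMr ?mulr_gt0 //; move: rhoP; lra.
have hpos : 0 < h s by apply: lt_le_trans hs0; apply: mulr_gt0 => //; apply: divr_gt0.
have [W /andP[cW pW]] : exists W : {set T}, (#|W| == r) && p W s.
  apply/existsP; apply: contraTT hpos => /existsPn np; rewrite -leNgt /h big1 // => W cW.
  by have := np W; rewrite cW /= => /negbTE->; rewrite mulr0.
have /andP[/and4P[us _ fs _] dsU] := pW.
have sU : seqset s \subset U by rewrite -(setCK U) -disjoints_subset.
have cs : #|seqset s| = m by rewrite card_seqset.
have [Y [YU cY fY bdY]] := compensate cU sU cs (leqnn B) kB gM.
exists s, Y; split=> //.
  apply: le_trans hs0 _; rewrite /h [leRHS]big_mkcondr /=; apply: ler_sum => W' _.
  rewrite /p; case: (absorbs e r W' s); rewrite /= ?mulr0 //.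
  by case: [disjoint _ & _]; rewrite ?mulr1 ?mulr0.
have dsY : [disjoint seqset s & Y].
  rewrite disjoint_sym; apply: disjointWl YU _; rewrite -setI_eq0; apply/eqP/setP => u.
  by rewrite !inE; case: (u \in s); rewrite ?andbF.
rewrite (sum_setU g dsY) [leRHS]mulrDr.
have sumseq (F : T -> R) : \sum_(x <- s) F x = \sum_(x in seqset s) F x.
  by rewrite big_uniq //; apply: eq_bigl => x; rewrite inE.
have FsE : \sum_(x <- s) G x = \sum_(x in seqset s) `|g x - gbar|.
  by rewrite sumseq; apply: eq_bigr => x /(subsetP sU) xU; rewrite /G xU.
have U0 : #|U|%:R != 0 :> R.
  rewrite pnatr_eq0 -lt0n; apply: leq_trans (subset_leq_card sU).
  by rewrite cs /m; move: r3; clear; lia.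
have Ug : #|U|%:R * gbar = \sum_(u in U) g u by rewrite /gbar mulrC divfK.
have hsg : m%:R * \sum_(u in U) g u - #|U|%:R * \sum_(x <- s) G x <= #|U|%:R * \sum_(u in seqset s) g u.
  rewrite -Ug mulrCA -mulrBr; apply: ler_wpM2l; first exact: ler0n.
  rewrite FsE lerBlDr -cs mulr_natl -sumr_const -big_split /=; apply: ler_sum => x _.
  by rewrite -lerBlDl distrC; apply: ler_norm.
have UF : #|U|%:R * \sum_(x <- s) G x <= 2 * m%:R / rho * Lam.
  have Un : #|U|%:R <= #|T|%:R :> R by rewrite ler_nat max_card.
  apply: (@le_trans _ _ (#|T|%:R * (2 * ((m * #|T| ^ m.-1)%:R * Lam) / c%:R ^+ m))).
    apply: ler_pM => //; by rewrite ?ler0n // sumr_ge0.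
  have -> : #|T|%:R * (2 * ((m * #|T| ^ m.-1)%:R * Lam) / c%:R ^+ m) =
     2 * m%:R * Lam * (#|T|%:R ^+ m / c%:R ^+ m).
    rewrite natrM natrX (_ : #|T|%:R ^+ m = #|T|%:R * #|T|%:R ^+ m.-1 :> R); first by ring.
    by rewrite -exprS prednK // /m; move: r3; clear; lia.
  rewrite [leRHS](_ : _ = 2 * m%:R * Lam * rho^-1); last by ring.
  apply: ler_wpM2l; first by rewrite !mulr_ge0.
  by rewrite ler_pdivrMr // ler_pdivlMl.
have BL : 2 * m%:R / rho * Lam <= B%:R * (r%:R * kap r / 2 * Lam).
  rewrite mulrA; apply: ler_wpM2r => //; rewrite ler_pdivrMr //; move: BP; lra.
have sum_up (mm bb rr S1 FF Ss Sy LL CM q : R) : mm * S1 - FF <= Ss -> FF <= q -> q <= bb * LL ->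
    bb * (rr * S1 + LL - CM) <= Sy -> (mm + bb * rr) * S1 - bb * CM <= Ss + Sy by lra.
have -> : l%:R = m%:R + B%:R * r%:R :> R by rewrite /l natrD [(B * r)%:R]natrM.
by rewrite -[_ * C' * M]mulrA; exact: sum_up hsg UF BL bdY.
Qed.

Let p v : R := #|[set: T] :\: adj e v|%:R / #|[set: T]|%:R.
Let Am : R := 4 * (B%:R * C') ^+ 4 + 19 * l%:R ^+ 4.
Let lr := (3 * r + B)%N.

(** A superstep halves terms that make up at least the proportion [rho / 2] of [wt], whence the
    factor [1 - rho / 4]. The [l = r * lr] vertices removed each time enter [potential_iter] as one
    step. *)
Lemma phase1_iter K i : rho <= 1 -> #|T| = (r * K)%N -> (i * lr + k1 <= K)%N ->
  (i * (r * lr) + 2 * r + 3 * r ^ 2 <= f)%N ->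
  exists (U : {set T}) fam,
   [/\ #|U| = (r * (K - i * lr))%N,
       potential e [set: T] p U <= Am * #|T|%:R * i.+1%:R ^+ 2 &
       wt fam <= wt [::] * (1 - rho / 4) ^+ i] /\
   [/\ pairwise (@wdisj T) fam,
       all (fun s : seq T => factor e r (seqset s)) fam,
       cov fam \subset ~: U & factor e r (~: U :\: cov fam)].
Proof.
move=> rho1 cT; have r0 : (0 < r)%N by apply: leq_trans r3.
have C'0 : 0 <= C' by apply: addr_ge0; rewrite ?mulr_ge0 ?exprn_ge0.
have C0 : 0 <= B%:R * C' by apply: mulr_ge0.
have Am0 : 0 <= Am by apply: addr_ge0; apply: mulr_ge0; rewrite ?exprn_ge0.
have lE : l = (r * lr)%N by rewrite /l /m /lr mulnDr; congr (_ + _)%N; rewrite ?expnS ?expn0 ?muln1 1?mulnCA // mulnC.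
have l0 : (0 < l)%N by rewrite lE muln_gt0 r0 /lr; move: r0; clear; lia.
elim: i => [|i IH] iK iF.
  exists [set: T], [::]; rewrite /cov big_nil setCT set0D factor0 sub0set; split; split=> //.
  - by rewrite cardsT cT mul0n subn0.
  - rewrite (_ : potential _ _ _ _ = 0) ?mulr_ge0 ?exprn_ge0 //.
    apply: big1 => v _; rewrite /posexc /excess /p divfK ?subrr ?maxxx ?expr0n //.
    by rewrite cardsT pnatr_eq0; move: roomP s0P r3; clear; lia.
  - by rewrite expr0 mulr1.
have iK' : (i * lr + k1 <= K)%N by apply: leq_trans iK; rewrite mulSn -addnA leq_addl.
have iF' : (i * (r * lr) + 2 * r + 3 * r ^ 2 <= f)%N.
  by apply: leq_trans iF; rewrite !leq_add2r leq_mul2r leqnSn orbT.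
have [U [fam [[cU pU wU] [dfam ffam cfam frest]]]] := IH iK' iF'.
have cUC : #|~: U| = (i * (r * lr))%N.
  apply/eqP; rewrite -(eqn_add2l #|U|) cardsC cT cU -mulnCA -mulnDr subnK //.
  by apply: leq_trans iK'; apply: leq_addr.
have kB : (k1 + 3 * r + B <= K - i * lr)%N.
  by move: iK; rewrite mulSn /lr; move: (i * (3 * r + B))%N; clear; lia.
have Uf : (#|~: U| + 2 * r + 3 * r ^ 2 <= f)%N by rewrite cUC.
have Phi0 : 0 < wt fam.
  have [|W _ cW] := @subset_of_card T setT r; first by rewrite cardsT; move: roomP s0P; clear; lia.
  rewrite /wt (bigD1 W) /=; last by rewrite cW.
  by apply: ltr_wpDr; [apply: sumr_ge0 => ? _|]; rewrite ?exprn_ge0 ?exprn_gt0 ?invr_ge0 ?invr_gt0 ?divr_gt0 ?divr_ge0.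
have w0 (W : {set T}) : 0 <= (1 / 2 : R) ^+ count (absorbs e r W) fam.
  by apply: exprn_ge0; apply: divr_ge0.
have [s [Y [[us ss sU fs] [YU cY fY] hit good]]] :=
  superstep cU kB Uf (pweight_bound e [set: T] p U) w0 Phi0.
have YsD u : u \in Y -> u \in U /\ u \notin seqset s.
  by move=> /(subsetP YU); rewrite in_setD => /andP[].
have dsY : [disjoint seqset s & Y].
  rewrite -setI_eq0; apply/eqP/setP => u; rewrite in_setI in_set0.
  by apply/negbTE/negP => /andP[us' /YsD[_]]; rewrite us'.
pose X := seqset s :|: Y.
have XU : X \subset U by rewrite subUset sU (subset_trans YU) // subsetDl.
have cX : #|X| = l by rewrite cardsU (disjoint_setI0 dsY) cards0 subn0 card_seqset // ss cY.
exists (U :\: X), (s :: fam); split; split.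
- by rewrite cardsD (setIidPr XU) cX cU lE mulSn [(lr + _)%N]addnC subnDA [RHS]mulnBr.
- rewrite -[#|T|]cardsT; apply: potential_iter XU cX l0 C0 good _; last by rewrite cardsT.
  move=> v _; apply/andP; split; first by apply: divr_ge0.
  rewrite /p ler_pdivrMr ?mul1r ?ler_nat ?subset_leq_card ?subsetT //.
  by rewrite ltr0n cardsT; move: roomP s0P r3; clear; lia.
- have -> : wt (s :: fam) = wt fam - 1 / 2 * \sum_(W : {set T} | (#|W| == r) && absorbs e r W s)
       (1 / 2) ^+ count (absorbs e r W) fam.
    rewrite /wt big_mkcondr mulr_sumr -sumrB; apply: eq_bigr => W _ /=.
    case: (absorbs e r W s); rewrite /= ?add1n ?add0n ?exprS ?mulr0 ?subr0 //.
    by rewrite -[X in _ = X - _]mul1r -mulrBl; congr (_ * _); lra.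
  rewrite exprS mulrCA.
  apply: (@le_trans _ _ ((1 - rho / 4) * wt fam)); last first.
    by apply: ler_wpM2l wU; move: rho1; lra.
  by move: hit; rewrite -/(wt fam); lra.
- rewrite /= dfam andbT; apply/allP => t tfam.
  apply: disjointWl sU _; rewrite disjoint_sym disjoints_subset; apply: subset_trans cfam.
  by rewrite /cov (big_rem t tfam) /= subsetUl.
- by rewrite /= fs.
- rewrite /cov big_cons subUset; apply/andP; split.
    by apply/subsetP => u us'; rewrite in_setC in_setD in_setU us'.
  by apply: subset_trans cfam _; rewrite setCS subsetDl.
rewrite (_ : _ :\: _ = (~: U :\: cov fam) :|: Y).
  apply: factorU => //; rewrite -setI_eq0; apply/eqP/setP => u; rewrite in_setI in_set0 in_setD in_setC.
  by apply/negbTE/negP => /andP[/andP[_ uU] /YsD[]]; rewrite (negbTE uU).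
apply/setP => u; rewrite /cov big_cons -/(cov fam) /X.
rewrite !(in_setD, in_setU, in_setC).
have [uY|uY] := boolP (u \in Y).
  have [uU us'] := YsD u uY; rewrite (negbTE us') uU !orbT /= andbT.
  by apply/negP => /(subsetP cfam); rewrite in_setC uU.
have [us'|us'] := boolP (u \in seqset s); last by rewrite /= !orbF.
by rewrite (subsetP sU _ us') ?andbF.
Qed.

End Phase1.

(** * Absorbing the leftover *)

Section Absorption.
Variables (T : finType) (e : rel T) (r : nat).

Lemma cov_cat (f1 f2 : seq (seq T)) : cov (f1 ++ f2) = cov f1 :|: cov f2.
Proof. by rewrite /cov big_cat. Qed.

Lemma cov_cons s (f : seq (seq T)) : cov (s :: f) = seqset s :|: cov f.
Proof. by rewrite /cov big_cons. Qed.

Lemma disjoint_cov (s : seq T) (f : seq (seq T)) : all (wdisj s) f -> [disjoint seqset s & cov f].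
Proof.
elim: f => [|t f IH] /=; first by rewrite /cov big_nil disjoint_sym -setI_eq0 set0I.
by move=> /andP[st sf]; rewrite cov_cons disjoint_setUr (st : is_true [disjoint _ & _]) IH.
Qed.

Lemma factor_cov (f : seq (seq T)) : pairwise (@wdisj T) f ->
  all (fun s : seq T => factor e r (seqset s)) f -> factor e r (cov f).
Proof.
elim: f => [|s f IH] /=; first by rewrite /cov big_nil factor0.
move=> /andP[sf df] /andP[fs ff]; rewrite cov_cons; apply: factorU => //.
  exact: disjoint_cov.
exact: IH.
Qed.

(** Greedy: the absorber used for [W] is discarded, which lowers the count of every other set by at
    most one while [q] drops by one. *)
Lemma absorb_all q (fam : seq (seq T)) (Z : {set T}) : (0 < r)%N ->
  (forall W : {set T}, #|W| = r -> (q <= count (absorbs e r W) fam)%N) ->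
  #|Z| = (r * q)%N -> [disjoint Z & cov fam] -> pairwise (@wdisj T) fam ->
  all (fun s : seq T => factor e r (seqset s)) fam -> factor e r (Z :|: cov fam).
Proof.
move=> r0; elim: q fam Z => [|q IH] fam Z cnt cZ dZ dfam ffam.
  by move: cZ; rewrite muln0 => /eqP; rewrite cards_eq0 => /eqP->; rewrite set0U factor_cov.
have [|W WZ cW] := @subset_of_card T Z r; first by rewrite cZ mulnS leq_addr.
have /hasP[s sfam absW] : has (absorbs e r W) fam.
  by rewrite has_count; apply: leq_trans (cnt W cW).
case/splitPr: sfam cnt dZ dfam ffam => f1 f2 cnt dZ dfam ffam.
have /and4P[_ dsW _ fWs] := absW.
move: dfam; rewrite pairwise_cat allrel_consr /= => /and3P[/andP[f1s f12] d1 /andP[sf2 d2]].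
move: ffam; rewrite all_cat /= => /and3P[ff1 fs ff2].
have covE : cov (f1 ++ s :: f2) = seqset s :|: cov (f1 ++ f2).
  by rewrite !cov_cat cov_cons setUCA.
have ds : [disjoint seqset s & cov (f1 ++ f2)].
  apply: disjoint_cov; rewrite all_cat sf2 andbT; apply/allP => t tf1.
  by rewrite /wdisj disjoint_sym; apply: (allP f1s).
move: dZ; rewrite covE disjoint_setUr => /andP[dZs dZc].
have fac2 : factor e r ((Z :\: W) :|: cov (f1 ++ f2)).
  apply: IH.
  - move=> W' cW'; have := cnt W' cW'; rewrite !count_cat /=.
    by case: (absorbs e r W' s); rewrite /= ?add1n ?addnS ?ltnS //= ?add0n; apply: ltnW.
  - by rewrite cardsD (setIidPr WZ) cZ cW mulnS addKn.
  - by apply: disjointWl dZc; apply: subsetDl.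
  - by rewrite pairwise_cat f12 d1 d2.
  - by rewrite all_cat ff1 ff2.
rewrite (_ : _ :|: _ = (W :|: seqset s) :|: ((Z :\: W) :|: cov (f1 ++ f2))); last first.
  apply/setP => u; rewrite !(in_setU, in_setD); case: (boolP (u \in W)) => [/(subsetP WZ)->|_] //=.
  by rewrite orbCA.
apply: factorU => //; rewrite disjoint_setUl !disjoint_setUr ds andbT; apply/andP; split.
  apply/andP; split; last exact: disjointWl WZ dZc.
  by rewrite -setI_eq0 setIDA setDIl setDv set0I.
by rewrite disjoint_sym; apply: disjointWl dZs; apply: subsetDl.
Qed.

End Absorption.

(** * Putting the phases together *)

Section Assemble.
Variables (R : realFieldType) (T : finType) (e : rel T) (r : nat).
Hypotheses (esym : symmetric e) (eirr : irreflexive e) (r3 : (2 < r)%N).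
Variables (D s0 c f : nat).
Hypotheses (oreP : ore e D) (edgesP : dense_edges e s0 c) (s0P : (2 * c + r <= s0)%N).
Hypotheses (DP : (c + f <= D)%N) (roomP : (s0 + (r - 1) * D + f <= #|T|)%N).
Variables (kap : nat -> R) (k1 : nat).
Hypothesis kapP : forall j, 0 <= kap j <= 1.
Hypothesis robP : forall k, (k1 <= k)%N -> (k * r <= #|T|)%N ->
  [/\ (k <= D)%N, (2 + r * (D - k) <= k)%N & robust e [set: T] k D r kap s0].
Variables (B : nat) (rho : R).
Hypotheses (rho0 : 0 < rho) (rho1 : rho <= 1) (rhoP : rho * #|T|%:R ^+ (3 * r ^ 2) <= c%:R ^+ (3 * r ^ 2)).
Hypothesis BP : 4 * (3 * r ^ 2)%:R <= B%:R * r%:R * kap r * rho.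
Let l := (3 * r ^ 2 + B * r)%N.
Let lr := (3 * r + B)%N.
Let Am : R := 4 * (B%:R * (2 * r%:R * l%:R + 2 * r%:R ^+ 3)) ^+ 4 + 19 * l%:R ^+ 4.
Variables (K N q s h kmin : nat) (zeta theta : R).
Hypotheses (cT : #|T| = (r * K)%N) (NK : (N * lr + k1 <= K)%N) (Nf : (N * (r * lr) + 2 * r + 3 * r ^ 2 <= f)%N).
Hypothesis qP : #|T|%:R ^+ r * (1 - rho / 4) ^+ N < (1 / 2) ^+ q.
Hypotheses (Ds : D = (K + s)%N) (zeta0 : 0 <= zeta) (zetaP : Am * #|T|%:R * N.+1%:R ^+ 2 <= zeta ^+ 4).
Hypotheses (NK1 : (N * lr < K)%N) (th01 : 0 < theta < 1).
Hypothesis hP : s%:R + zeta + theta * (K + h)%:R <= h%:R.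
Hypothesis bigP : (4 * (2 * r%:R ^+ 3) ^+ 4 + 19 * r%:R ^+ 4) * (r * (K + h))%:R * (K + h).+1%:R ^+ 2
    <= (theta * kmin%:R) ^+ 4.
Hypotheses (kmin2 : (2 <= kmin)%N) (kminP : (kmin + N * lr <= K)%N) (leftP : (kmin + r * h <= q)%N).

Lemma wt_nil_le : wt R e r [::] <= #|T|%:R ^+ r.
Proof.
rewrite /wt (eq_bigr (fun=> 1)) // sumr_const (_ : #|_| = 'C(#|T|, r)); last first.
  by rewrite -card_draws cardsE.
rewrite -natrX ler_nat; apply: (@leq_trans ('C(#|T|, r) * r`!)).
  by rewrite leq_pmulr // fact_gt0.
rewrite bin_ffact ffact_prod; apply: (@leq_trans (\prod_(i < r) #|T|)).
  by apply: leq_prod => i _; apply: leq_subr.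
by rewrite prod_nat_const card_ord.
Qed.

Lemma assemble : factor e r [set: T].
Proof.
have r0 : (0 < r)%N by apply: leq_trans r3.
have [U [fam [[cU pU wU] [dfam ffam cfam frest]]]] :=
  phase1_iter esym eirr r3 oreP edgesP s0P DP roomP kapP robP rho0 rhoP BP rho1 cT NK Nf.
rewrite -/lr in cU; set k := (K - N * lr)%N in cU.
(* The term of a set with fewer than [q] absorbers would be at least [(1 / 2) ^ q], but by [qP] the
   total weight is smaller. *)
have cnt (W : {set T}) : #|W| = r -> (q <= count (absorbs e r W) fam)%N.
  move=> cW; rewrite leqNgt; apply/negP => lt; suff: (1 / 2 : R) ^+ q < (1 / 2) ^+ q by rewrite ltxx.
  apply: le_lt_trans qP; apply: (@le_trans _ _ (wt R e r fam)).
    apply: (@le_trans _ _ ((1 / 2) ^+ count (absorbs e r W) fam)).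
      by apply: ler_wiXn2l; rewrite ?(ltnW lt) //; lra.
    rewrite /wt (bigD1 W) /=; last by rewrite cW.
    by rewrite lerDl; apply: sumr_ge0 => ? _; apply: exprn_ge0; apply: divr_ge0.
  apply: le_trans wU _; apply: ler_wpM2r; first by apply: exprn_ge0; move: rho1; lra.
  exact: wt_nil_le.
have K0 : 0 < K%:R :> R by rewrite ltr0n; apply: leq_ltn_trans NK1.
have Kn0 : K%:R != 0 :> R by rewrite gt_eqF.
have rn0 : r%:R != 0 :> R by rewrite pnatr_eq0 -lt0n.
have kK : (k <= K)%N by apply: leq_subr.
have [th0 th1] := andP th01.
have excle v : #|U :\: adj e v|%:R <= #|nonadj e v|%:R / K%:R * k%:R + zeta.
  have := @excess_le R T e [set: T] _ U v zeta (in_setT v) zeta0 (le_trans pU zetaP).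
  rewrite /excess cardsT cT cU !natrM lerBlDl setTD setC_adj => h1; apply: le_trans h1 _.
  by rewrite lerD2r le_eqVlt; apply/orP; left; apply/eqP; field; rewrite Kn0 rn0.
(* The bound [2 * (K + s)] valid in the whole graph scales by [k / K] and grows by at most
   [2 * zeta]; [hP] compares the result with the bound for [k + h]. *)
have ore2 x y : x \in U -> y \in U -> x != y -> ~~ e x y ->
    #|U :\: adj e x|%:R + #|U :\: adj e y|%:R <= 2 * (1 - theta) * (k + h)%:R :> R.
  move=> _ _ xy nxy; have := oreP xy nxy; rewrite Ds -(ler_nat R) natrD natrM natrD => o.
  have k0 : 0 <= k%:R / K%:R :> R by apply: divr_ge0.
  have kK1 : k%:R / K%:R <= 1 :> R by rewrite ler_pdivrMr // mul1r ler_nat.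
  have h1 := ler_wpM2r k0 o.
  have h2 : s%:R * (k%:R / K%:R) <= s%:R * 1 :> R by apply: ler_wpM2l.
  have h3 : K%:R * (k%:R / K%:R) = k%:R :> R by rewrite mulrC divfK.
  have h4 : theta * (k + h)%:R <= theta * (K + h)%:R.
    by apply: ler_wpM2l; [exact: ltW|rewrite ler_nat leq_add2r].
  have h5 := hP; rewrite !natrD in h4 h5 *.
  move: (excle x) (excle y) h1 h2 h3 h4 h5; rewrite -!mulrA [_^-1 * _]mulrC.
  move: (k%:R / K%:R) => kr; lra.
have [Z [ZU cZ fZ]] : exists Z : {set T}, [/\ Z \subset U, (#|Z| <= r * kmin + r * (r * h))%N & factor e r (U :\: Z)].
  apply: leftover_factor ore2 _ _ => //.
  - by rewrite subn_gt0.
  - apply: le_trans bigP; apply: ler_pM; rewrite ?mulr_ge0 ?exprn_ge0 //.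
    + by apply: addr_ge0; apply: mulr_ge0; rewrite ?exprn_ge0 ?mulr_ge0 ?exprn_ge0.
    + apply: ler_wpM2l; last by rewrite ler_nat leq_pmul2l // leq_add2r.
      by apply: addr_ge0; apply: mulr_ge0; rewrite ?exprn_ge0 ?mulr_ge0 ?exprn_ge0.
    + by rewrite lerXn2r ?nnegrE // ler_nat ltnS leq_add2r.
  - by apply: leq_trans (leq_addr _ _); rewrite leq_subRL 1?addnC // ltnW.
(* The sizes of [U] and of its tiled part are multiples of [r], hence so is that of [Z], as
   [absorb_all] requires. *)
have [z cZz] : exists z, #|Z| = (r * z)%N.
  have /dvdnP[z1 Ez1] := dvdn_factor fZ; exists (k - z1)%N.
  by move: Ez1; rewrite cardsD (setIidPr ZU) cU mulnBr [(r * z1)%N]mulnC => <-; rewrite subKn // -cU subset_leq_card.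
have zq : (z <= q)%N.
  by rewrite -(leq_pmul2l r0) -cZz (leq_trans cZ) // -mulnDr leq_pmul2l.
have dZ : [disjoint Z & cov fam].
  by rewrite disjoint_sym disjoints_subset (subset_trans cfam) // setCS.
have fA : factor e r (Z :|: cov fam).
  apply: (absorb_all r0 _ cZz dZ dfam ffam) => W cW; exact: leq_trans zq (cnt W cW).
rewrite (_ : setT = (U :\: Z) :|: ((Z :|: cov fam) :|: (~: U :\: cov fam))); last first.
  apply/setP => u; rewrite !(in_setU, in_setD, in_setC, in_setT).
  by case: (u \in Z); case: (u \in U); case: (u \in cov fam).
apply: factorU => //; last apply: factorU => //.
- rewrite disjoint_setUr disjoint_setUr -!setI_eq0 -andbA; apply/and3P; split; apply/eqP/setP => u.
  + by rewrite !(in_setI, in_setD, in_set0); case: (u \in Z); rewrite ?andbF.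
  + rewrite !(in_setI, in_setD, in_set0); apply/negbTE/negP => /andP[/andP[_ uU] /(subsetP cfam)].
    by rewrite in_setC uU.
  + by rewrite !(in_setI, in_setD, in_setC, in_set0); case: (u \in U); rewrite ?andbF.
- rewrite disjoint_setUl -!setI_eq0; apply/andP; split; apply/eqP/setP => u.
    rewrite !(in_setI, in_setD, in_setC, in_set0).
    by apply/negbTE/negP => /andP[/(subsetP ZU) -> /andP[]].
  by rewrite !(in_setI, in_setD, in_setC, in_set0); case: (u \in cov fam); rewrite ?andbF.
Qed.

End Assemble.

(** * The constants *)

Lemma bernoulli (R : realFieldType) (x : R) a : 0 <= x -> 1 + a%:R * x <= (1 + x) ^+ a.
Proof.
move=> x0; elim: a => [|a IH]; first by rewrite mul0r addr0 expr0.
have x1 : 0 <= 1 + x by apply: addr_ge0.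
have := ler_wpM2l x1 IH; rewrite -exprS; apply: le_trans.
have : 0 <= x * (a%:R * x) by rewrite !mulr_ge0.
by rewrite -[a.+1%:R]natr1; move: x0; clear; lra.
Qed.

(** Each block of [a] factors is at most one half, since [1 - rho / 4] times [1 + rho / 4] is at
    most one and [bernoulli] bounds the powers of the latter. Of the [(2 * r + 1) * y] halvings,
    [2 * r * y] beat [n ^ r <= y ^ (2 * r)] because [y < 2 ^ y]; the other [y] remain. *)
Lemma decay_bound (R : realFieldType) (rho : R) (a y r n : nat) :
  0 < rho <= 1 -> 4 / rho <= a%:R -> (0 < r)%N -> (n <= y ^ 2)%N ->
  n%:R ^+ r * (1 - rho / 4) ^+ (a * ((2 * r + 1) * y)) < (1 / 2 : R) ^+ y.
Proof.
move=> /andP[rho0 rho1] arho r0 ny.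
have half : (1 - rho / 4) ^+ a <= 1 / 2.
  have x0 : 0 <= rho / 4 by apply: divr_ge0 => //; apply: ltW.
  have hb := bernoulli a x0.
  have h2 : 2 <= (1 + rho / 4) ^+ a.
    apply: le_trans hb; rewrite ler_pdivrMr // in arho; move: arho; clear; lra.
  have h1 : (1 - rho / 4) ^+ a * (1 + rho / 4) ^+ a <= 1.
    rewrite -exprMn -[leRHS](expr1n _ a); apply: lerXn2r; rewrite ?nnegrE.
    - by apply: mulr_ge0; move: rho0 rho1; clear; lra.
    - exact: ler01.
    - by move: (sqr_ge0 (rho / 4)); clear; lra.
  have h3 : 0 <= (1 - rho / 4) ^+ a by apply: exprn_ge0; move: rho1; clear; lra.
  have : (1 - rho / 4) ^+ a * 2 <= (1 - rho / 4) ^+ a * (1 + rho / 4) ^+ a by apply: ler_wpM2l.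
  by move: h1; clear; lra.
have d0 : 0 <= 1 - rho / 4 by move: rho1; clear; lra.
have h1 : (1 - rho / 4) ^+ (a * ((2 * r + 1) * y)) <= (1 / 2) ^+ ((2 * r + 1) * y).
  by rewrite exprM; apply: lerXn2r; rewrite ?nnegrE ?exprn_ge0 //; apply: divr_ge0.
apply: (@le_lt_trans _ _ (n%:R ^+ r * (1 / 2) ^+ ((2 * r + 1) * y))).
  by apply: ler_wpM2l => //; apply: exprn_ge0.
rewrite mulnDl mul1n exprD mulrA -[ltRHS]mul1r ltr_pM2r; last by apply: exprn_gt0; apply: divr_gt0.
have -> : (2 * r * y = y * 2 * r)%N by rewrite mulnC mulnA.
have half0 : 0 <= (1 / 2 : R) by apply: divr_ge0.
rewrite exprM -exprMn exprn_ilt1 -?lt0n //; first by apply: mulr_ge0 => //; apply: exprn_ge0.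
rewrite exprM; apply: (@le_lt_trans _ _ ((y%:R * (1 / 2) ^+ y) ^+ 2)).
  rewrite [leRHS]exprMn; apply: ler_wpM2r; first exact: sqr_ge0.
  by rewrite -natrX ler_nat.
rewrite exprn_ilt1 //; first by apply: mulr_ge0 => //; apply: exprn_ge0.
rewrite mul1r exprVn ltr_pdivrMr ?exprn_gt0 // mul1r -natrX ltr_nat.
exact: ltn_expl.
Qed.

(** Starting the gains at [delta / 50] makes [25 * kap j * k] at most [delta * K / 2], well inside
    the margin [delta * r * K] between [s0] and [K]. The bounds on [t1] and [s] keep [D - k] near
    [kap r / (16 * r) * K] at most, small even against the last gain. *)
Lemma robust_kap (R : realFieldType) (T : finType) (e : rel T) (r K k s s0 t1 : nat) (delta : R) :
  let kap j := delta / 50 / (400 * r%:R) ^+ j in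
  (2 < r)%N -> 0 < delta <= 1 / (4 * r%:R) -> (k <= K)%N -> (K <= k + t1)%N ->
  t1%:R <= kap r / (32 * r%:R) * K%:R -> s%:R <= kap r / (32 * r%:R) * K%:R + 1 ->
  s0%:R <= K%:R - delta * r%:R * K%:R + 1 ->
  32 * r%:R / kap r <= K%:R -> (1 + r%:R) / delta <= K%:R -> 8 * r%:R <= K%:R :> R ->
  (forall S : {set T}, (s0 <= #|S|)%N -> exists2 x, x \in S & exists2 y, y \in S & e x y) ->
  [/\ (k <= K + s)%N, (2 + r * (K + s - k) <= k)%N & robust e [set: T] k (K + s) r kap s0].
Proof.
move=> kap r3 /andP[d0 d1] kK Kt t1P sP s0P K1 K2 K3 edge.
have r3R : 3 <= r%:R :> R by rewrite ler_nat.
have r0 : 0 < r%:R :> R by apply: lt_le_trans r3R.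
have base1 : 1 <= 400 * r%:R :> R by move: r3R; clear; lra.
have kap0 j : 0 < kap j by rewrite /kap divr_gt0 ?exprn_gt0 ?divr_gt0 // (lt_le_trans ltr01).
have kapd j : kap j <= delta / 50.
  rewrite /kap ler_pdivrMr ?exprn_gt0 ?(lt_le_trans ltr01) // ler_peMr ?exprn_ege1 //.
  by apply: divr_ge0 => //; apply: ltW.
have kapr j : (j <= r)%N -> kap r <= kap j.
  move=> jr; rewrite /kap; apply: ler_wpM2l; first by apply: divr_ge0 => //; apply: ltW.
  rewrite lef_pV2 ?posrE ?exprn_gt0 ?(lt_le_trans ltr01) //.
  by apply: ler_weXn2l.
have kapS j : kap j.+1 * (400 * r%:R) <= kap j.
  have cancel (x z b : R) : b != 0 -> x / (z * b) * b = x / z by move=> b0; rewrite invfM mulrA divfK.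
  by rewrite /kap exprSr cancel // gt_eqF // (lt_le_trans ltr01).
clearbody kap.
have d2 : delta <= 1 / 12.
  apply: le_trans d1 _; rewrite ler_pdivrMr; last by move: r0; clear; lra.
  by move: r3R; clear; lra.
have KK0 : 0 <= K%:R :> R by apply: ler0n.
have ka := kap0 r; have kad := kapd r.
have small : kap r / (32 * r%:R) * K%:R <= kap r / 96 * K%:R.
  apply: ler_wpM2r => //; rewrite ler_pdivrMr; last by move: r0; clear; lra.
  have : kap r * 3 <= kap r * r%:R by apply: ler_wpM2l => //; apply: ltW.
  by clear; lra.
have smallr : r%:R * (kap r / (32 * r%:R) * K%:R) = kap r / 32 * K%:R.
  by field; rewrite gt_eqF.
have kR : K%:R <= k%:R + t1%:R :> R by rewrite -natrD ler_nat.
have kKR : k%:R <= K%:R :> R by rewrite ler_nat.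
have kaK : kap r * K%:R <= delta / 50 * K%:R by apply: ler_wpM2r.
have dK : delta * K%:R <= 1 / 12 * K%:R by apply: ler_wpM2r.
have dKr : delta * 3 * K%:R <= delta * r%:R * K%:R.
  by apply: ler_wpM2r => //; apply: ler_wpM2l => //; apply: ltW.
rewrite ler_pdivrMr // in K1; rewrite ler_pdivrMr // in K2.
have kbig : 9 / 10 * K%:R <= k%:R :> R by move: kR t1P small kaK dK KK0; clear; lra.
have kD : (k <= K + s)%N by apply: leq_trans kK (leq_addr _ _).
have DR : (K + s - k)%:R = K%:R + s%:R - k%:R :> R by rewrite natrB // natrD.
have rD : 4 * r%:R * (K%:R + s%:R - k%:R) <= kap r * k%:R.
  have h1 : r%:R * (K%:R + s%:R - k%:R) <= r%:R * (kap r / (32 * r%:R) * K%:R + (kap r / (32 * r%:R) * K%:R + 1)).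
    by apply: ler_wpM2l; [exact: ltW|move: kR t1P sP; clear; lra].
  have h2 : kap r * (9 / 10 * K%:R) <= kap r * k%:R by apply: ler_wpM2l => //; apply: ltW.
  move: (kap r / (32 * r%:R) * K%:R) h1 smallr => Q h1 smallr.
  by move: h1 h2 smallr K1 r0; clear; lra.
split=> //.
  rewrite -(ler_nat R) natrD natrM DR.
  have : kap r * k%:R <= delta / 50 * k%:R by apply: ler_wpM2r.
  have : delta * k%:R <= 1 / 12 * k%:R by apply: ler_wpM2r.
  by move: rD kbig K3 r3R; clear; lra.
split=> //.
- by move=> S _; apply: edge.
- move=> j; rewrite kap0 /=; split=> //.
  by apply: le_trans (kapd j) _; move: d2; clear; lra.
- move=> j jr; rewrite natrD; apply: le_trans rD _; apply: ler_wpM2r => //; exact: kapr.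
- move=> j; have : kap j * k%:R <= delta / 50 * k%:R by apply: ler_wpM2r.
  have : delta * k%:R <= delta * K%:R by apply: ler_wpM2l => //; apply: ltW.
  have : 0 <= delta * K%:R by apply: mulr_ge0 => //; apply: ltW.
  by move: s0P kR t1P small kaK dKr K2; clear; lra.
- rewrite -(ler_nat R) natrM; move: kbig K3 r3R; clear; lra.
Qed.

Lemma ex_floor (R : realType) (x : R) : 0 <= x -> exists t : nat, t%:R <= x < t%:R + 1.
Proof. by move=> x0; exists (Num.truncn x); rewrite natr1 Num.Theory.truncn_itv. Qed.

(** Order of the choices: [delta] determines the gains and [rho], then [B] and [a], then [mu], where
    about [mu * K] absorbers are reserved for each set. Only then is [alpha] bounded, so that the
    leftover fits these reserves. *)
Lemma factor_of_dense (R : realType) (r : nat) (delta : R) :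
  (2 < r)%N -> 0 < delta <= 1 / (4 * r%:R) ->
  exists2 alpha0 : R, 0 < alpha0 & forall alpha, 0 < alpha -> alpha <= alpha0 ->
  exists X : R, forall K : nat, X <= K%:R -> forall (T : finType) (e : rel T),
    symmetric e -> irreflexive e -> #|T| = (r * K)%N ->
    (forall x y, x != y -> ~~ e x y ->
       (#|nonadj e x| + #|nonadj e y|)%:R <= 2 * (K%:R + alpha * r%:R * K%:R)) ->
    (forall S : {set T}, K%:R - delta * r%:R * K%:R <= #|S|%:R ->
       exists2 A : {set T}, A \subset S & delta * r%:R * K%:R <= #|A|%:R /\
         forall v, v \in A -> delta * r%:R * K%:R <= #|S :&: adj e v|%:R) ->
    factor e r [set: T].
Proof.
move=> r3 /andP[d0 d1]; have r0 : (0 < r)%N by apply: leq_trans r3.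
have r3R : 3 <= r%:R :> R by rewrite ler_nat.
have rr0 : 0 < r%:R :> R by apply: lt_le_trans r3R.
pose kap j : R := delta / 50 / (400 * r%:R) ^+ j.
have base1 : 1 <= 400 * r%:R :> R by move: r3R; clear; lra.
have d2 : delta <= 1 / 12.
  by apply: le_trans d1 _; rewrite ler_pdivrMr; move: r3R; clear; lra.
have kap0 j : 0 < kap j by rewrite /kap divr_gt0 ?exprn_gt0 ?divr_gt0 // (lt_le_trans ltr01).
have kapd j : kap j <= delta / 50.
  rewrite /kap ler_pdivrMr ?exprn_gt0 ?(lt_le_trans ltr01) // ler_peMr ?exprn_ege1 //.
  by apply: divr_ge0 => //; apply: ltW.
have kap01 j : 0 <= kap j <= 1.
  by rewrite (ltW (kap0 j)) (le_trans (kapd j)) //; move: d2; clear; lra.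
have [ka [kaE ka0 kad]] : exists ka, [/\ kap r = ka, 0 < ka & ka <= delta / 50] by exists (kap r).
(* [c] will be about [delta * n / 2], so [c / n] is at least [delta / 4] for large [K]. *)
pose m := (3 * r ^ 2)%N; pose rho : R := (delta / 4) ^+ m.
have rho0 : 0 < rho by apply: exprn_gt0; apply: divr_gt0.
have rho1 : rho <= 1.
  by apply: exprn_ile1; [apply: divr_ge0 => //; apply: ltW|move: d2; clear; lra].
have [B BP] : exists B : nat, 4 * m%:R <= B%:R * r%:R * ka * rho.
  have [|t /andP[_ tP]] := @ex_floor R (4 * m%:R / (r%:R * ka * rho)).
    by apply: divr_ge0; rewrite ?mulr_ge0 // ltW.
  exists t.+1; rewrite ltr_pdivrMr ?mulr_gt0 // natr1 in tP.
  by move: (ltW tP); rewrite !mulrA.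
have [a aP] : exists a : nat, 4 / rho <= a%:R.
  have [|t /andP[_ tP]] := @ex_floor R (4 / rho); first by apply: divr_ge0 => //; apply: ltW.
  by exists t.+1; rewrite -[t.+1%:R]natr1 ltW.
have a4 : 4 <= a%:R :> R.
  by apply: le_trans aP; rewrite ler_pdivlMr // ler_piMr.
have a0 : 0 < a%:R :> R by apply: lt_le_trans a4.
pose lr := (3 * r + B)%N; pose l := (3 * r ^ 2 + B * r)%N.
have lr1 : 1 <= lr%:R :> R by rewrite ler1n /lr; move: r3; clear; lia.
pose Am : R := 4 * (B%:R * (2 * r%:R * l%:R + 2 * r%:R ^+ 3)) ^+ 4 + 19 * l%:R ^+ 4.
pose A2 : R := 4 * (2 * r%:R ^+ 3) ^+ 4 + 19 * r%:R ^+ 4.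
have Am0 : 0 <= Am.
  apply: addr_ge0; apply: mulr_ge0 => //; apply: exprn_ge0 => //.
  by apply: mulr_ge0 => //; apply: addr_ge0; rewrite ?mulr_ge0 ?exprn_ge0.
have A20 : 0 <= A2.
  by apply: addr_ge0; apply: mulr_ge0 => //; apply: exprn_ge0 => //; rewrite mulr_ge0 ?exprn_ge0.
pose eta := ka / (32 * r%:R).
have eta0 : 0 < eta by apply: divr_gt0 => //; apply: mulr_gt0.
have eta1 : eta <= ka / 96.
  rewrite /eta ler_pdivrMr ?mulr_gt0 //.
  have : ka * 3 <= ka * r%:R by apply: ler_wpM2l => //; apply: ltW.
  by clear; lra.
pose w : R := a%:R * (2 * r%:R + 1).
have w0 : 0 < w by apply: mulr_gt0 => //; move: rr0; clear; lra.
have w1 : 1 <= w by apply: mulr_ege1; [move: a4|move: r3R]; clear; lra.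
(* About [w * mu * K] supersteps of [r * lr] vertices then use at most [eta / 4 * r * K]
   vertices. *)
pose mu := eta / (4 * lr%:R) / w.
have lr0 : 0 < lr%:R :> R by apply: lt_le_trans lr1.
have mu0 : 0 < mu by apply: divr_gt0 => //; apply: divr_gt0 => //; apply: mulr_gt0.
have wmu : w * mu * lr%:R = eta / 4.
  by rewrite /mu; field; rewrite !gt_eqF.
have mu1 : mu <= eta / 4.
  rewrite -wmu mulrAC -[leLHS]mul1r; apply: ler_wpM2r; first exact: ltW.
  exact: mulr_ege1.
have [etaE wE rhoE] : [/\ kap r / (32 * r%:R) = eta, w = a%:R * (2 * r%:R + 1) & rho = (delta / 4) ^+ m].
  by rewrite kaE.
have [AmE A2E] : Am = Am /\ A2 = A2 by [].
rewrite {1}/Am /l in AmE; rewrite {1}/A2 in A2E.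
clearbody eta mu w rho Am A2.
(* The three bounds serve the room needed by [many_absorbs], the slack [s] in [robust], and the
   leftover of about [2 * alpha * r ^ 2 * K] groups of [r] vertices caused by the universal
   vertices. *)
exists (Num.min (delta / (4 * r%:R)) (Num.min (ka / (32 * r%:R ^+ 2)) (mu / (16 * r%:R ^+ 2)))).
  rewrite !lt_min; apply/and3P; split; apply: divr_gt0 => //; apply: mulr_gt0 => //.
    exact: exprn_gt0.
  exact: exprn_gt0.
move=> alpha al0; rewrite !le_min => /and3P[al1 al2 al3].
have al1' : alpha * r%:R <= delta / 4.
  by rewrite ler_pdivlMr ?mulr_gt0 // in al1; move: al1; clear; lra.
have al2' : alpha * r%:R <= eta.
  rewrite ler_pdivlMr ?mulr_gt0 ?exprn_gt0 // in al2.
  rewrite -etaE kaE ler_pdivlMr ?mulr_gt0 //; move: al2; clear; lra.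
have al3' : alpha * r%:R * r%:R <= mu / 16.
  rewrite ler_pdivlMr ?mulr_gt0 ?exprn_gt0 // in al3; by move: al3; clear; lra.
(* Lower bounds on [K], one for each kind of estimate; [b7] and [b8] are those where a fourth power
   of [K] has to beat a potential of order [K ^ 3]. *)
pose b1 := 40 * r%:R / delta; pose b2 := 32 * r%:R / ka; pose b3 : R := 8 * r%:R.
pose b4 := 4 * r%:R / mu ^+ 2; pose b5 := (16 * r%:R + 16) / mu; pose b6 := 2 / eta.
pose b7 := Am * r%:R / alpha ^+ 4; pose b8 := 48 * A2 * r%:R / (alpha * mu / 16) ^+ 4.
have r_ge0 : 0 <= r%:R :> R by apply: ltW.
have b1_ge0 : 0 <= b1 by apply: divr_ge0; [exact: mulr_ge0|exact: ltW].
have b2_ge0 : 0 <= b2 by apply: divr_ge0; [exact: mulr_ge0|exact: ltW].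
have b3_ge0 : 0 <= b3 by apply: mulr_ge0.
have b4_ge0 : 0 <= b4 by apply: divr_ge0; [exact: mulr_ge0|apply: exprn_ge0; exact: ltW].
have b5_ge0 : 0 <= b5 by apply: divr_ge0; [apply: addr_ge0 => //; exact: mulr_ge0|exact: ltW].
have b6_ge0 : 0 <= b6 by apply: divr_ge0 => //; apply: ltW.
have b7_ge0 : 0 <= b7 by apply: divr_ge0; [exact: mulr_ge0|apply: exprn_ge0; exact: ltW].
have am0 : 0 < alpha * mu / 16 by apply: divr_gt0 => //; apply: mulr_gt0.
have b8_ge0 : 0 <= b8.
  apply: divr_ge0; last by apply: exprn_ge0; apply: ltW.
  by apply: mulr_ge0 => //; apply: mulr_ge0.
exists (b1 + b2 + b3 + b4 + b5 + b6 + b7 + b8) => K XK.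
have [K1 K2 K3 K4] : [/\ b1 <= K%:R, b2 <= K%:R, b3 <= K%:R & b4 <= K%:R].
  by split; move: b1_ge0 b2_ge0 b3_ge0 b4_ge0 b5_ge0 b6_ge0 b7_ge0 b8_ge0 XK; clear; lra.
have [K5 K6 K7 K8] : [/\ b5 <= K%:R, b6 <= K%:R, b7 <= K%:R & b8 <= K%:R].
  by split; move: b1_ge0 b2_ge0 b3_ge0 b4_ge0 b5_ge0 b6_ge0 b7_ge0 b8_ge0 XK; clear; lra.
rewrite /b1 ler_pdivrMr // in K1; have K2' := K2; rewrite /b2 ler_pdivrMr // in K2; rewrite /b3 in K3.
rewrite /b4 ler_pdivrMr ?exprn_gt0 // in K4; rewrite /b5 ler_pdivrMr // in K5.
rewrite /b6 ler_pdivrMr // in K6; rewrite /b7 ler_pdivrMr ?exprn_gt0 // in K7.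
rewrite /b8 ler_pdivrMr ?exprn_gt0 // in K8.
move=> T e esym eirr cT ore edges {XK b1_ge0 b2_ge0 b3_ge0 b4_ge0 b5_ge0 b6_ge0 b7_ge0 b8_ge0}.
have KK0 : 0 <= K%:R :> R by apply: ler0n.
have a1K : alpha * r%:R * K%:R <= delta / 4 * K%:R by apply: ler_wpM2r.
have a2K : alpha * r%:R * K%:R <= eta * K%:R by apply: ler_wpM2r.
have a3K : alpha * r%:R * r%:R * K%:R <= mu / 16 * K%:R by apply: ler_wpM2r.
have dK1 : delta * K%:R <= 1 / 12 * K%:R by apply: ler_wpM2r.
have dK2 : delta * r%:R * K%:R <= 1 / 4 * K%:R.
  apply: ler_wpM2r => //; rewrite ler_pdivlMr ?mulr_gt0 // in d1; move: d1; clear; lra.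
have dK3 : 3 * (delta * K%:R) <= delta * r%:R * K%:R.
  by rewrite mulrA [3 * _]mulrC; apply: ler_wpM2r => //; apply: ler_wpM2l => //; apply: ltW.
have dK0 : 0 <= delta * K%:R by apply: mulr_ge0 => //; apply: ltW.
have etaK : eta * K%:R <= delta / 4800 * K%:R.
  by apply: ler_wpM2r => //; move: eta1 kad; clear; lra.
have muK : mu * K%:R <= eta / 4 * K%:R by apply: ler_wpM2r.
have etaK0 : 0 <= eta * K%:R by apply: mulr_ge0 => //; apply: ltW.
have alK0 : 0 <= alpha * K%:R by apply: mulr_ge0 => //; apply: ltW.
have muK0 : 0 <= mu * K%:R by apply: mulr_ge0 => //; apply: ltW.
have alrK : 3 * (alpha * K%:R) <= alpha * r%:R * K%:R.
  by rewrite mulrA [3 * _]mulrC; apply: ler_wpM2r => //; apply: ler_wpM2l => //; apply: ltW.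
have [|c /andP[c1 c2]] := @ex_floor R (delta * r%:R * K%:R / 2); first by move: dK3 dK0; clear; lra.
have [|s' /andP[s1' s2']] := @ex_floor R (alpha * r%:R * K%:R); first by move: alrK alK0; clear; lra.
have [|t0 /andP[t01 t02]] := @ex_floor R (delta * r%:R * K%:R); first by move: dK3 dK0; clear; lra.
have [|f /andP[f1 f2]] := @ex_floor R (delta * r%:R * K%:R / 4); first by move: dK3 dK0; clear; lra.
have [t1 /andP[t11 t12]] := ex_floor etaK0.
have [y /andP[y1 y2]] := ex_floor muK0.
have [|kq /andP[kq1 kq2]] := @ex_floor R (mu * K%:R / 8); first by apply: divr_ge0.
(* [s] is rounded up to cover the deficit [alpha * r * K]; [y] absorbers are reserved for each set,
   [N] supersteps provide them, and the tiling stops at [kmin]. *)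
pose s := s'.+1; pose N := (a * ((2 * r + 1) * y))%N; pose kmin := kq.+2.
have sR : s%:R = s'%:R + 1 :> R by rewrite -[LHS]natr1.
have NR : N%:R = w * y%:R :> R by rewrite /N wE !natrM natrD natrM mulrA.
have kminR : kmin%:R = kq%:R + 2 :> R by rewrite /kmin -addn2 natrD.
have lrE : (3 * r + B)%N = lr by [].
have NE : N = (a * ((2 * r + 1) * y))%N by [].
have kmin2 : (2 <= kmin)%N by [].
clearbody s N kmin lr.
have NlrR : N%:R * lr%:R <= eta / 4 * K%:R.
  rewrite NR -wmu mulrAC -[leRHS]mulrA [lr%:R * K%:R]mulrC mulrA [leLHS]mulrAC.
  by apply: ler_wpM2r => //; rewrite -mulrA; apply: ler_wpM2l => //; apply: ltW.
have NRle : N%:R <= eta / 4 * K%:R.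
  by apply: le_trans NlrR; rewrite ler_peMr.
have r2K : 40 * r%:R * r%:R <= delta * r%:R * K%:R.
  have := ler_wpM2r r_ge0 K1; clear; lra.
have rr3 : 3 * r%:R <= r%:R * r%:R :> R by apply: ler_wpM2r.
have t0K : (t0 <= K)%N by rewrite -(ler_nat R); move: t01 dK2 KK0; clear; lra.
have t1K : (t1 <= K)%N by rewrite -(ler_nat R); move: t11 etaK dK1 KK0; clear; lra.
have c_pos : (0 < c)%N by rewrite -(ltr_nat R); move: c2 r2K rr3 r3R; clear; lra.
have s0R : (K - t0)%:R = K%:R - t0%:R :> R by rewrite natrB.
have edgesP : dense_edges e (K - t0) c.
  move=> S; rewrite -(ler_nat R) s0R => hS.
  have [|A AS [cA vA]] := edges S; first by move: hS t01; clear; lra.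
  exists A => //; split=> [|v /vA cv]; rewrite -(ler_nat R).
    by move: c1 cA dK3 dK0; clear; lra.
  by move: c1 cv dK3 dK0; clear; lra.
have K10 : 10 * r%:R <= delta * K%:R by move: K1 r_ge0; clear; lra.
(* In [h = 2 * s] one copy of [s] makes up for the deficit; as [s] is larger than [3 * alpha * K],
   the other one pays for [zeta = alpha * K] and for [theta * (K + h)] with [theta = alpha / 2]. *)
apply: (@assemble R T e r esym eirr r3 (K + s) (K - t0) c f _ edgesP _ _ _ kap (K - t1) kap01 _
   B rho rho0 rho1 _ _ K N y s (2 * s) kmin (alpha * K%:R) (alpha / 2) cT).
- move=> x z xz nxz; rewrite -(ler_nat R) [(2 * _)%:R]natrM [(K + s)%:R]natrD sR; have := ore x z xz nxz.
  by move: s2'; clear; lra.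
- rewrite -(ler_nat R) natrD natrM s0R; move: c1 t01 dK2 K3 r_ge0; clear; lra.
- rewrite -(ler_nat R) !natrD sR; move: c1 f1 dK2 KK0 s1' s2' alrK alK0; clear; lra.
- rewrite -(ler_nat R) cT !natrD !natrM s0R !natrD sR natrB //.
  have h1 : r%:R * s'%:R <= r%:R * (alpha * r%:R * K%:R) by apply: ler_wpM2l.
  have h2 : r%:R * (alpha * r%:R * K%:R) <= r%:R * (delta / 4 * K%:R) by apply: ler_wpM2l.
  have h3 : 0 <= s'%:R :> R by [].
  by move: h1 h2 h3 f1 t02 K10 rr3 r3R r2K; clear; lra.
- move=> k kt; rewrite cT mulnC leq_pmul2l // => kK.
  apply: (@robust_kap R T e r K k s (K - t0) t1 delta); rewrite // -/(kap r) ?etaE //.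
  + by rewrite d0.
  + by rewrite addnC -leq_subLR.
  + by rewrite sR; move: s1' a2K; clear; lra.
  + by rewrite s0R; move: t02; clear; lra.
  + by rewrite kaE.
  + by rewrite ler_pdivrMr //; move: K10 r3R; clear; lra.
  + move=> S hS; have [A AS [cA vA]] := edgesP S hS.
    have [x xA] : exists x, x \in A by apply/set0Pn; rewrite -cards_eq0 -lt0n; apply: leq_trans cA.
    have [z zA] : exists z, z \in S :&: adj e x.
      by apply/set0Pn; rewrite -cards_eq0 -lt0n; apply: leq_trans (vA x xA).
    exists x; first exact: (subsetP AS).
    by move: zA; rewrite !inE => /andP[zS xz]; exists z.
- rewrite rhoE -exprMn; apply: lerXn2r; rewrite ?nnegrE ?mulr_ge0 ?divr_ge0 ?invr_ge0 ?(ltW d0) //.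
  by rewrite cT natrM; move: c2 r2K rr3 r3R; clear; lra.
- by rewrite kaE.
- rewrite lrE -(ler_nat R) natrD natrM natrB //; move: NlrR t12 K6; clear; lra.
- rewrite lrE -(ler_nat R) !natrD !natrM.
  have h1 : r%:R * (N%:R * lr%:R) <= r%:R * (eta / 4 * K%:R) by apply: ler_wpM2l.
  have h2 : r%:R * (eta * K%:R) <= r%:R * (delta / 4800 * K%:R) by apply: ler_wpM2l.
  by move: h1 h2 f2 r2K rr3 r3R; clear; lra.
- rewrite NE; apply: decay_bound => //; first by rewrite rho0.
  rewrite cT -(ler_nat R) natrM natrX.
  have h1 : (mu * K%:R / 2) ^+ 2 <= y%:R ^+ 2.
    by apply: lerXn2r; rewrite ?nnegrE ?divr_ge0 //; move: y2 K5 r3R; clear; lra.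
  have := ler_wpM2r KK0 K4; move: h1; clear; lra.
- by [].
- exact: alK0.
- rewrite AmE cT natrM exprMn.
  have N1 : N.+1%:R <= K%:R :> R by rewrite -natr1; move: NRle etaK dK1 K3 r3R; clear; lra.
  have h1 : N.+1%:R ^+ 2 <= K%:R ^+ 2 :> R by apply: lerXn2r; rewrite ?nnegrE.
  have h2 : Am * (r%:R * K%:R) * N.+1%:R ^+ 2 <= Am * (r%:R * K%:R) * K%:R ^+ 2.
    by apply: ler_wpM2l => //; rewrite !mulr_ge0.
  have h3 : 0 <= K%:R ^+ 3 :> R by apply: exprn_ge0.
  by have := ler_wpM2r h3 K7; move: h2; clear; lra.
- rewrite lrE -(ltr_nat R) natrM; move: NlrR etaK dK1 K3 r3R; clear; lra.
- apply/andP; split; first exact: divr_gt0.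
  have : alpha * 3 <= alpha * r%:R by apply: ler_wpM2l => //; apply: ltW.
  by move: al1' d2; clear; lra.
- have h1 : alpha * s%:R <= 1 / 100 * s%:R.
    apply: ler_wpM2r => //; have : alpha * 3 <= alpha * r%:R by apply: ler_wpM2l => //; apply: ltW.
    by move: al1' d2; clear; lra.
  have h2 : 0 <= s%:R :> R by [].
  rewrite [(K + _)%:R]natrD [(2 * s)%:R]natrM; rewrite sR in h1 h2 *; move: alrK s2' h1 h2; clear; lra.
- rewrite A2E [(r * _)%:R]natrM -[(K + 2 * s).+1%:R]natr1 [(K + 2 * s)%:R]natrD [(2 * s)%:R]natrM sR.
  have u1 : K%:R + 2 * (s'%:R + 1) <= 3 * K%:R :> R by move: s1' a1K dK1 K3 r3R; clear; lra.
  have u2 : K%:R + 2 * (s'%:R + 1) + 1 <= 4 * K%:R :> R by move: u1 K3 r3R; clear; lra.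
  have u0 : 0 <= K%:R + 2 * (s'%:R + 1) :> R.
    by apply: addr_ge0 => //; apply: mulr_ge0 => //; apply: addr_ge0.
  have h1 : (K%:R + 2 * (s'%:R + 1) + 1) ^+ 2 <= (4 * K%:R) ^+ 2 :> R.
    by apply: lerXn2r u2; rewrite nnegrE; [exact: addr_ge0|exact: mulr_ge0].
  have h2 : A2 * (r%:R * (K%:R + 2 * (s'%:R + 1))) * (K%:R + 2 * (s'%:R + 1) + 1) ^+ 2 <=
      A2 * (r%:R * (3 * K%:R)) * (4 * K%:R) ^+ 2.
    apply: ler_pM h1; last by apply: ler_wpM2l => //; apply: ler_wpM2l.
      by apply: mulr_ge0 => //; apply: mulr_ge0.
    by apply: exprn_ge0; apply: addr_ge0.
  have h3 : (alpha * mu / 16) ^+ 4 * K%:R ^+ 4 <= (alpha / 2 * kmin%:R) ^+ 4.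
    rewrite -exprMn; apply: lerXn2r; rewrite ?nnegrE.
    - by apply: mulr_ge0 => //; apply: ltW.
    - by apply: mulr_ge0 => //; apply: divr_ge0 => //; apply: ltW.
    have : alpha / 2 * (mu * K%:R / 8) <= alpha / 2 * kmin%:R.
      by apply: ler_wpM2l; [apply: divr_ge0 => //; exact: ltW|rewrite kminR; move: kq2; clear; lra].
    by clear; lra.
  have h4 : 0 <= K%:R ^+ 3 :> R by apply: exprn_ge0.
  by have := ler_wpM2r h4 K8; move: h2 h3; move: ((alpha * mu / 16) ^+ 4) => x; clear; lra.
- exact: kmin2.
- rewrite lrE -(ler_nat R) natrD natrM kminR; move: kq1 muK NlrR etaK dK1 K3 r3R KK0; clear; lra.
- rewrite -(ler_nat R) natrD !natrM kminR sR.
  have h1 : r%:R * s'%:R <= r%:R * (alpha * r%:R * K%:R) by apply: ler_wpM2l.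
  by move: h1 kq1 a3K y2 K5 r3R; clear; lra.
Qed.

(** * From the absence of sparse sets to the density condition *)

Lemma edges_in_le (T : finType) (e : rel T) (S : {set T}) :
  (edges_in e S <= \sum_(v in S) #|S :&: adj e v|)%N.
Proof.
apply: (@leq_trans #|\bigcup_(v in S) [set [set v; u] | u in S :&: adj e v]|).
  apply: subset_leq_card; apply/subsetP => A; rewrite inE -andbA => /and3P[AS cA /forall_inP kA].
  case/cards2P: cA AS kA => x [y [xy ->]] AS kA.
  move: AS; rewrite subUset !sub1set => /andP[xS yS].
  apply/bigcupP; exists x => //; apply: imset_f; rewrite !inE yS /=.
  have /kA/forall_inP kx : x \in [set x; y] by rewrite !inE eqxx.
  have /kx : y \in [set x; y] by rewrite !inE eqxx orbT.
  by rewrite xy.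
elim/big_ind2: _ => [|A a C b Aa Cb|v _]; first by rewrite cards0.
  by apply: leq_trans (leq_card_setU _ _) _; apply: leq_add.
exact: leq_imset_card.
Qed.

Lemma ex_resize (T : finType) (S : {set T}) K : (K <= #|T|)%N ->
  exists2 S' : {set T}, #|S'| = K & (#|S' :\: S| <= K - #|S|)%N.
Proof.
move=> KT; have [KS|SK] := leqP K #|S|.
  have [S' SS' cS'] := subset_of_card KS; exists S' => //.
  by move: SS'; rewrite -setD_eq0 => /eqP->; rewrite cards0.
have [|A AS cA] := @subset_of_card T (~: S) (K - #|S|).
  by rewrite leq_subLR cardsC.
have dSA : [disjoint S & A] by rewrite disjoint_sym disjoints_subset.
exists (S :|: A).
  by rewrite cardsU (disjoint_setI0 dSA) cards0 subn0 cA subnKC // ltnW.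
by rewrite setDUl setDv set0U -cA subset_leq_card // subsetDl.
Qed.

(** [S] is resized to [S'] with exactly [K] vertices, hence with more than [4 * delta * n ^ 2]
    edges; so at least [2 * delta * n] of its vertices have [2 * delta * n] neighbours in it. At
    most [delta * n] vertices were added, and half of each quantity survives in [S]. *)
Lemma dense_of_not_sparse (R : realType) (T : finType) (e : rel T) (K : nat) (delta : R) (S : {set T}) :
  (K <= #|T|)%N ->
  (forall S' : {set T}, #|S'| = K -> 4 * delta * #|T|%:R ^+ 2 < (edges_in e S')%:R) ->
  0 < delta -> K%:R - delta * #|T|%:R <= #|S|%:R ->
  exists2 A : {set T}, A \subset S & delta * #|T|%:R <= #|A|%:R /\
    forall v, v \in A -> delta * #|T|%:R <= #|S :&: adj e v|%:R.
Proof.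
move=> KT dense d0 hS; have [S' cS' dS'] := ex_resize S KT.
set n : R := #|T|%:R in dense hS *.
have n0 : 0 <= n by apply: ler0n.
have dn0 : 0 <= delta * n by apply: mulr_ge0 => //; apply: ltW.
have dS'R : #|S' :\: S|%:R <= delta * n.
  have [KS|SK] := leqP K #|S|.
    by move: dS'; rewrite (eqP KS) leqn0 => /eqP->.
  apply: (@le_trans _ _ (K - #|S|)%:R); first by rewrite ler_nat.
  by rewrite natrB ?(ltnW SK) //; move: hS; clear; lra.
have split_le (X : {set T}) : X \subset S' -> #|X|%:R <= #|X :&: S|%:R + delta * n.
  move=> XS'; rewrite -(cardsID S X) natrD lerD2l; apply: le_trans dS'R.
  by rewrite ler_nat; apply/subset_leq_card/setSD.
pose A := [set v in S' | 2 * delta * n <= #|S' :&: adj e v|%:R].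
have AS' : A \subset S' by apply/subsetP => v; rewrite inE => /andP[].
have cA : 2 * delta * n <= #|A|%:R.
  have h1 : (\sum_(v in S') #|S' :&: adj e v|)%:R <= #|A|%:R * n + n * (2 * delta * n).
    rewrite natr_sum (sum_setD _ AS'); apply: lerD.
      by rewrite mulr_natl -sumr_const; apply: ler_sum => v _; rewrite ler_nat max_card.
    apply: (@le_trans _ _ (#|S' :\: A|%:R * (2 * delta * n))).
      rewrite mulr_natl -sumr_const; apply: ler_sum => v.
      by rewrite !inE => /andP[+ vS']; rewrite vS' /= -ltNge => /ltW.
    by apply: ler_wpM2r; [rewrite -mulrA mulr_ge0|rewrite ler_nat max_card].
  have := dense S' cS'; have := edges_in_le e S'; rewrite -(ler_nat R) => h2 h3.
  rewrite leNgt; apply/negP => lt.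
  have : #|A|%:R * n <= 2 * delta * n * n by apply: ler_wpM2r => //; apply: ltW.
  by move: h1 h2 h3; clear; lra.
exists (A :&: S); first exact: subsetIr.
split; first by have := split_le A AS'; move: cA; clear; lra.
move=> v; rewrite !inE => /andP[/andP[vS' vA] vS].
have := split_le _ (subsetIl S' (adj e v)); rewrite setIAC => h.
have : #|S' :&: S :&: adj e v|%:R <= #|S :&: adj e v|%:R :> R.
  by rewrite ler_nat subset_leq_card // setSI // subsetIr.
by move: h vA; clear; lra.
Qed.

Theorem theorem3p1 (R : realType) (r : nat) (hr : (3 <= r)%N) :
  exists2 gamma0 : R, 0 < gamma0 &
  forall gamma : R, 0 < gamma -> gamma <= gamma0 ->
  exists2 alpha0 : R, 0 < alpha0 &
  forall alpha : R, 0 < alpha -> alpha <= alpha0 ->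
  exists n0 : nat, forall n : nat, (n0 <= n)%N -> (r %| n)%N ->
  forall e : rel 'I_n, simple_graph e ->
    sigma_ge e (2 * (1 - (r%:R)^-1 - alpha) * n%:R) ->
    (forall S : {set 'I_n}, #|S| = (n %/ r)%N -> ~ gamma_indep n e gamma S) ->
    Kr_factor e r.
Proof.
have r0 : (0 < r)%N by apply: leq_trans hr.
have rr0 : 0 < r%:R :> R by rewrite ltr0n.
(* With [delta = gamma / 4], this is the condition [delta <= 1 / (4 * r)]. *)
exists (r%:R)^-1; first by rewrite invr_gt0.
move=> gamma g0 g1.
have [|alpha0 al0 main] := @factor_of_dense R r (gamma / 4) hr.
  rewrite divr_gt0 //= ler_pdivlMr ?mulr_gt0 //.
  have : gamma * r%:R <= 1 by rewrite -ler_pdivlMr // mul1r.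
  by clear; lra.
exists alpha0 => // alpha a0 a1; have [X HX] := main alpha a0 a1.
have [t tP] : exists t : nat, X <= t%:R.
  have [X0|X0] := leP 0 X; last by exists 0%N; apply: ltW.
  by have [t /andP[_ lt]] := ex_floor X0; exists t.+1; rewrite -natr1 ltW.
exists (r * t)%N => n nt /dvdnP[K nE] e [esym eirr] ore dense.
have KE : (n %/ r = K)%N by rewrite nE mulnK.
have nR : n%:R = r%:R * K%:R :> R by rewrite nE natrM mulrC.
have cT : #|'I_n| = n by rewrite card_ord.
have adjC x : #|nonadj e x|%:R = n%:R - (deg e x)%:R :> R.
  have := cardsC (adj e x); rewrite setC_adj cT => E.
  have -> : n%:R = #|nonadj e x|%:R + #|adj e x|%:R :> R by rewrite -natrD addnC E.
  by rewrite addrK.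
suff fac : factor e r [set: 'I_n] by apply/factorP.
apply: (HX K) => //.
- apply: le_trans tP _; rewrite ler_nat -(leq_pmul2l r0); apply: leq_trans nt _.
  by rewrite nE mulnC.
- by rewrite cT nE mulnC.
(* Counted by non-neighbours, the degree bound becomes [2 * n - 2 * (1 - 1 / r - alpha) * n = 2 * (K
   + alpha * r * K)]. *)
- move=> x y xy nxy; have := ore x y xy nxy; rewrite !natrD !adjC nR.
  have -> : 2 * (1 - r%:R^-1 - alpha) * (r%:R * K%:R) =
     2 * (r%:R * K%:R - K%:R - alpha * r%:R * K%:R) :> R by field; rewrite gt_eqF.
  by clear; lra.
have dn : gamma / 4 * r%:R * K%:R = gamma / 4 * #|'I_n|%:R :> R by rewrite cT nR mulrA.
rewrite dn => S hS; apply: dense_of_not_sparse hS; last exact: divr_gt0.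
  by rewrite cT nE leq_pmulr.
move=> S' cS'; rewrite ltNge; apply/negP => h; apply: (dense S'); first by rewrite KE.
by move: h; rewrite cT [4 * _]mulrC divfK // pnatr_eq0.
Qed.
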